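(* Let $d\geq 1$ and let $h_1,h_2,\dots,h_s\in\mathbb{R}^d$ be finitely many vectors that span a dense additive subgroup of $\mathbb{R}^d$, i.e. $h_1\mathbb{Z}+\cdots+h_s\mathbb{Z}$ is dense in $\mathbb{R}^d$. Let $f$ be a (complex-valued) distribution on $\mathbb{R}^d$ such that there exist natural numbers $n_i$, $i=1,\dots,s$, satisfying $$\dim \mathrm{span}\{f,\tau_{h_i}(f),\dots,(\tau_{h_i})^{n_i}(f)\}\leq n_i,\qquad i=1,\dots,s.$$ Then $f$ is, in the distributional sense, a continuous exponential polynomial; that is, there is an exponential polynomial $p:\mathbb{R}^d\to\mathbb{C}$ such that $f$ is the distribution defined by $p$. In particular, $f$ is an ordinary function which is equal almost everywhere, with respect to Lebesgue measure, to an exponential polynomial.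
   Context: For $h\in\mathbb{R}^d$, $\tau_h$ denotes the translation operator: $\tau_h(f)(x)=f(x+h)$ for functions $f$, extended to distributions by duality, i.e. $\langle\tau_h(f),\varphi\rangle=\langle f,\varphi(\cdot-h)\rangle$ for all test functions $\varphi\in C_c^\infty(\mathbb{R}^d)$. $(\tau_h)^k$ is the $k$-th iterate of $\tau_h$, so $(\tau_h)^k=\tau_{kh}$. Spans and dimensions are those of complex vector spaces. An exponential polynomial on $\mathbb{R}^d$ is a finite sum $x\mapsto\sum_{k}P_k(x)e^{\langle\lambda_k,x\rangle}$, where each $P_k$ is a polynomial in $d$ variables with complex coefficients, $\lambda_k\in\mathbb{C}^d$, and $\langle\lambda,x\rangle=\sum_{j=1}^d\lambda_jx_j$ (the zero function is included). *)

(* Defs.v *)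
From HB Require Import structures.
From mathcomp Require Import all_boot all_order all_algebra.
From mathcomp Require Import all_classical all_reals all_analysis.
From mathcomp Require complex mpoly.

Set Implicit Arguments.
Unset Strict Implicit.
Unset Printing Implicit Defensive.

Import Order.TTheory GRing.Theory Num.Theory.
Import numFieldNormedType.Exports.
Import complex.

Local Open Scope classical_set_scope.
Local Open Scope ring_scope.
Local Open Scope complex_scope.

Section test_functions.
Variables (R : realType) (d : nat).
Implicit Types (u v : 'rV[R]_d -> R) (s : seq 'I_d).

(* A list [:: j1; ...; jk] stands for the operator d_{j1} ... d_{jk}, so that
   multi-indices of length at most N are the lists of size at most N. *)
Definition partials s u : 'rV[R]_d -> R :=
  foldr (fun j v x => 'D_(delta_mx 0 j) v x) u s.

(* C^oo: all iterated partial derivatives exist and are continuous *)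
Definition smooth u := forall s,
  continuous (partials s u) /\
  forall j x, derivable (partials s u) x (delta_mx 0 j).

Lemma partialsD s u v : smooth u -> smooth v ->
  partials s (u \+ v) = partials s u \+ partials s v.
Proof.
move=> su sv; elim: s => //= j s ->; apply/funext => x.
by rewrite deriveD//; [exact: (su s).2|exact: (sv s).2].
Qed.

Lemma partialsZ s (c : R) u : smooth u ->
  partials s (c \*: u) = c \*: partials s u.
Proof.
move=> su; elim: s => //= j s ->; apply/funext => x.
by rewrite deriveZ//; exact: (su s).2.
Qed.

Lemma partials_shift s u (a : 'rV[R]_d) :
  partials s (fun x => u (x + a)) = fun x => partials s u (x + a).
Proof.
elim: s => //= j s ->; apply/funext => x.
rewrite /derive.
suff -> : (fun h : R => h^-1 *: (((fun y => partials s u (y + a)) \o shift x)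
      (h *: delta_mx 0 j) - partials s u (x + a))) =
    (fun h => h^-1 *: ((partials s u \o shift (x + a)) (h *: delta_mx 0 j)
      - partials s u (x + a))) by [].
by apply/funext => h /=; rewrite addrA.
Qed.

Lemma smoothD u v : smooth u -> smooth v -> smooth (u \+ v).
Proof.
move=> su sv s; rewrite partialsD//; split=> [x|j x].
  by apply: continuousD; [exact: (su s).1|exact: (sv s).1].
by apply: derivableD; [exact: (su s).2|exact: (sv s).2].
Qed.

Lemma smoothZ (c : R) u : smooth u -> smooth (c \*: u).
Proof.
move=> su s; rewrite partialsZ//; split=> [x|j x].
  by apply: continuousZr; exact: (su s).1.
by apply: derivableZ; exact: (su s).2.
Qed.

Lemma smooth0 : smooth (fun=> 0).
Proof.
move=> s; have -> : partials s (fun=> 0) = fun=> 0.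
  by elim: s => //= j s ->; apply/funext => x; rewrite derive_cst.
by split=> [x|j x]; [exact: cst_continuous|exact: derivable_cst].
Qed.

Lemma smooth_shift u (a : 'rV[R]_d) :
  smooth u -> smooth (fun x => u (x + a)).
Proof.
move=> su s; rewrite partials_shift; split=> [x|j x].
  have ca : {for x, continuous (fun y : 'rV[R]_d => y + a)}.
    by apply: continuousD; [exact: id|exact: cst_continuous].
  exact: (continuous_comp ca ((su s).1 (x + a))).
have := (su s).2 j (x + a); rewrite /derivable.
suff -> : (fun h : R => h^-1 *: (((fun y => partials s u (y + a)) \o shift x)
      (h *: delta_mx 0 j) - partials s u (x + a))) =
    (fun h => h^-1 *: ((partials s u \o shift (x + a)) (h *: delta_mx 0 j)
      - partials s u (x + a))) by [].
by apply/funext => h /=; rewrite addrA.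
Qed.

Implicit Types phi psi : 'rV[R]_d -> R[i].

Definition csmooth phi :=
  smooth (fun x => Re (phi x)) /\ smooth (fun x => Im (phi x)).

Definition cpartials s phi : 'rV[R]_d -> R[i] := fun x =>
  partials s (fun y => Re (phi y)) x +i* partials s (fun y => Im (phi y)) x.

Definition supp phi : set 'rV[R]_d := closure [set x | phi x != 0].

Definition test_function : {pred 'rV[R]_d -> R[i]} :=
  mem [set phi | csmooth phi /\ compact (supp phi)].

Lemma test_functionP phi :
  reflect (csmooth phi /\ compact (supp phi)) (phi \in test_function).
Proof. by apply: (iffP idP) => [/set_mem|?]; last exact/mem_set. Qed.

Lemma supp_compact_sub phi (K : set 'rV[R]_d) :
  compact K -> (forall x, phi x != 0 -> K x) -> compact (supp phi).
Proof.
move=> cK sK; apply: (subclosed_compact _ cK); first exact: closed_closure.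
have /closure_id -> : closed K by apply: compact_closed.
exact: closureS.
Qed.

Lemma test_function_submod : submod_closed test_function.
Proof.
split.
  apply/test_functionP; split; first by split; exact: smooth0.
  apply: (supp_compact_sub compact0) => x.
  by rewrite eqxx.
move=> c phi psi /test_functionP[[rp ip] cp] /test_functionP[[rq iq] cq].
have reE : (fun x => Re ((c *: phi + psi) x)) =
    ((Re c \*: (fun x => Re (phi x))) \+ ((- Im c) \*: (fun x => Im (phi x))))
    \+ (fun x => Re (psi x)).
  apply/funext => x.
  have H (e z w : R[i]) : Re (e * z + w) = Re e * Re z + - Im e * Im z + Re w.
    by case: e => a b; case: z => u v; case: w => u1 v1 /=; rewrite mulNr.
  exact: H.
have imE : (fun x => Im ((c *: phi + psi) x)) =
    ((Re c \*: (fun x => Im (phi x))) \+ (Im c \*: (fun x => Re (phi x))))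
    \+ (fun x => Im (psi x)).
  apply/funext => x.
  have H (e z w : R[i]) : Im (e * z + w) = Re e * Im z + Im e * Re z + Im w.
    by case: e => a b; case: z => u v; case: w => u1 v1.
  exact: H.
apply/test_functionP; split.
  split.
    by rewrite reE; exact: (smoothD (smoothD (smoothZ _ rp) (smoothZ _ ip)) rq).
  by rewrite imE; exact: (smoothD (smoothD (smoothZ _ ip) (smoothZ _ rp)) iq).
apply: (supp_compact_sub (compactU cp cq)) => x.
have [px _|/negPn/eqP px] := boolP (phi x != 0).
  by left; exact: subset_closure.
have [qx _|/negPn/eqP qx] := boolP (psi x != 0).
  by right; exact: subset_closure.
have -> : (c *: phi + psi) x = c *: phi x + psi x by [].
by rewrite px qx scaler0 addr0 eqxx.
Qed.

Lemma test_function_shift phi (a : 'rV[R]_d) :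
  phi \in test_function -> (fun x => phi (x + a)) \in test_function.
Proof.
move=> /test_functionP[[rp ip] cp]; apply/test_functionP; split.
  by split; [exact: (smooth_shift a rp)|exact: (smooth_shift a ip)].
pose t := fun x : 'rV[R]_d => x - a.
have ct : continuous t.
  by move=> x; apply: continuousB; [exact: id|exact: cst_continuous].
apply: (@supp_compact_sub _ (t @` supp phi)).
  by apply: continuous_compact => //; exact: continuous_subspaceT.
move=> x px; exists (x + a); last by rewrite /t addrK.
exact: subset_closure.
Qed.

HB.instance Definition _ :=
  GRing.isSubmodClosed.Build R[i] ('rV[R]_d -> R[i]) test_function
    test_function_submod.

Record testfun := TestFun {
  testfun_val :> 'rV[R]_d -> R[i];
  testfunP : testfun_val \in test_function }.

HB.instance Definition _ := [isSub for testfun_val].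
HB.instance Definition _ := [Choice of testfun by <:].
HB.instance Definition _ := [SubChoice_isSubLmodule of testfun by <:].

Definition testfun_shift (a : 'rV[R]_d) (phi : testfun) : testfun :=
  TestFun (test_function_shift a (testfunP phi)).

End test_functions.

Section spans.
Variables (K : fieldType) (V : lmodType K).

Definition lin_comb n (v : 'I_n -> V) (a : 'I_n -> K) : V :=
  \sum_(i < n) a i *: v i.

Definition lin_span n (v : 'I_n -> V) : set V := range (lin_comb v).

Definition lin_indep n (v : 'I_n -> V) :=
  forall a, lin_comb v a = 0 -> forall i, a i = 0.

Definition has_dim (W : set V) (m : nat) :=
  exists b : 'I_m -> V, lin_indep b /\ lin_span b = W.

Definition dim_le (W : set V) (n : nat) :=
  exists m, (m <= n)%N /\ has_dim W m.

End spans.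

Section distributions.
Variables (R : realType) (d : nat).
Local Notation normc := ComplexField.Normc.normc.

(* The C^N norm max_{|alpha| <= N} sup |d^alpha phi| *)
Definition testfun_norm (N : nat) (phi : testfun R d) : R :=
  sup [set normc (cpartials s phi x) |
        s in [set s : seq 'I_d | (size s <= N)%N] & x in [set: 'rV[R]_d]].

(* Not necessarily continuous, or even linear: the ambient complex vector space
   in which linear spans of distributions are taken *)
Definition functional := testfun R d -> R[i].
HB.instance Definition _ := GRing.Lmodule.on functional.

Definition is_distribution (f : functional) :=
  linear (f : testfun R d -> R[i]^o) /\
  forall K : set 'rV[R]_d, compact K -> exists C N,
    forall phi : testfun R d, supp phi `<=` K ->
      normc (f phi) <= C * testfun_norm N phi.

(* <tau_h f, phi> = <f, phi(. - h)> *)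
Definition tau (h : 'rV[R]_d) (f : functional) : functional :=
  fun phi => f (testfun_shift (- h) phi).

End distributions.

Definition rV_display : measure_display -> measure_display.
Proof. exact. Qed.

(* The sigma-algebra generated by the coordinates; for T the real numbers it is
   the Borel sigma-algebra of R^n *)
Section measurable_rV.
Context {d0 : measure_display} {T : measurableType d0}.
Variable n : nat.

Definition rV_coord (i : 'I_n) (x : 'rV[T]_n) : T := x ord0 i.

Let rV_set0 : g_sigma_preimage rV_coord set0.
Proof. exact: sigma_algebra0. Qed.

Let rV_setC A : g_sigma_preimage rV_coord A ->
  g_sigma_preimage rV_coord (~` A).
Proof. exact: sigma_algebraC. Qed.

Let rV_bigcup (F : (set 'rV[T]_n)^nat) :
  (forall i, g_sigma_preimage rV_coord (F i)) ->
  g_sigma_preimage rV_coord (\bigcup_i (F i)).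
Proof. exact: sigma_algebra_bigcup. Qed.

HB.instance Definition _ := @isMeasurable.Build (rV_display d0)
  'rV[T]_n (g_sigma_preimage rV_coord) rV_set0 rV_setC rV_bigcup.

Lemma measurable_rV_coord i : measurable_fun [set: 'rV[T]_n] (rV_coord i).
Proof.
move=> _ Y mY; rewrite setTI; apply: sub_sigma_algebra => /=.
rewrite -bigcup_seq/=; exists i => /=; first by rewrite mem_index_enum.
by exists Y => //; rewrite setTI.
Qed.

Lemma measurable_fun_rV d1 (T1 : measurableType d1) (f : T1 -> 'rV[T]_n) :
  (forall i, measurable_fun [set: T1] (fun x => f x ord0 i)) ->
  measurable_fun [set: T1] f.
Proof.
move=> mf.
suff H : g_sigma_preimage rV_coord `<=` image_set_system setT f measurable.
  by move=> _ A /H.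
apply: smallest_sub.
  exact/sigma_algebra_image/sigma_algebra_measurable.
move=> A; rewrite -bigcup_seq => -[i _ [B mB <-]].
rewrite /image_set_system/= !setTI.
by have := mf i measurableT _ mB; rewrite setTI.
Qed.

End measurable_rV.

Section lebesgue_rV.
Context {R : realType}.


Definition rV_cons n (p : R * 'rV[R]_n) : 'rV[R]_n.+1 :=
  row_mx p.1%:M p.2.

Definition rV_uncons n (x : 'rV[R]_n.+1) : R * 'rV[R]_n :=
  (x ord0 ord0, \row_j x ord0 (lift ord0 j)).

Lemma rV_cons0 n p : @rV_cons n p ord0 ord0 = p.1.
Proof.
have e : lshift n (ord0 : 'I_1) = ord0 :> 'I_n.+1 by exact/val_inj.
rewrite -(congr1 (rV_cons p ord0) e) [LHS]row_mxEl.
by rewrite mxE eqxx.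
Qed.

Lemma rV_consS n p j : @rV_cons n p ord0 (lift ord0 j) = p.2 ord0 j.
Proof.
have e : rshift 1 j = lift ord0 j :> 'I_n.+1 by exact/val_inj.
by rewrite -(congr1 (rV_cons p ord0) e) [LHS]row_mxEr.
Qed.

Lemma rV_consK n : cancel (@rV_cons n) (@rV_uncons n).
Proof.
move=> [a x]; congr pair; first by rewrite rV_cons0.
by apply/rowP => j; rewrite mxE rV_consS.
Qed.

Lemma measurable_rV_cons n : measurable_fun setT (@rV_cons n).
Proof.
apply: measurable_fun_rV => i.
have [->|[k ->]] : i = ord0 \/ exists k, i = lift ord0 k.
  by have [k ->|->] := unliftP ord0 i; [right; exists k|left].
  under eq_fun do rewrite rV_cons0.
  exact: measurable_fst.
under eq_fun do rewrite rV_consS.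
apply: (measurableT_comp (measurable_rV_coord k)).
exact: measurable_snd.
Qed.

Lemma measurable_rV_uncons n : measurable_fun setT (@rV_uncons n).
Proof.
apply: measurable_fun_pair.
  exact: (measurable_rV_coord ord0).
apply: measurable_fun_rV => i.
rewrite (_ : (fun _ => _) = rV_coord (lift ord0 i)).
  exact: measurable_rV_coord.
by apply/funext => x; rewrite mxE.
Qed.

Section step.
Variables (n : nat) (mu : {sigma_finite_measure set 'rV[R]_n -> \bar R}).

Definition leb_step : set 'rV[R]_n.+1 -> \bar R :=
  pushforward (lebesgue_measure \x mu)%E (@rV_cons n).

HB.instance Definition _ := Measure.copy leb_step
  (measure_function_pushforward__canonical__measure_function_Measure
    (lebesgue_measure \x mu)%E (@measurable_rV_cons n)).

(* the library's sigma-finite instance for a product of sigma-finite measures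
   is shadowed by the one for products of subprobabilities *)
Let product_sigma_finite : sigma_finite setT (@lebesgue_measure R \x mu)%E.
Proof.
have /sigma_finiteP[F [TF ndF Foo]] := sigma_finiteT (@lebesgue_measure R).
have /sigma_finiteP[G [TG ndG Goo]] := sigma_finiteT mu.
exists (fun n => F n `*` G n).
 rewrite -setXTT TF TG predeqE => -[x y]; split.
    move=> [/= [k _ Fnx] [l _ Gky]]; exists (maxn k l) => //; split.
    - by move: x Fnx; exact/subsetPset/ndF/leq_maxl.
    - by move: y Gky; exact/subsetPset/ndG/leq_maxr.
  by move=> [k _ []/= ? ?]; split; exists k.
move=> k; have [? ?] := Foo k; have [? ?] := Goo k.
split; first exact: measurableX.
by rewrite product_measure1E// lte_mul_pinfty// ge0_fin_numE.
Qed.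

Let leb_step_sigma_finite : sigma_finite setT leb_step.
Proof.
have [F FT Foo] := product_sigma_finite.
exists (fun k => @rV_uncons n @^-1` F k).
  by rewrite -preimage_bigcup -FT preimage_setT.
move=> k; split.
  rewrite -[X in measurable X]setTI.
  by apply: measurable_rV_uncons => //; exact: (Foo k).1.
rewrite /leb_step /pushforward -comp_preimage.
rewrite (_ : _ \o _ = id); last by apply/funext => x; rewrite /= rV_consK.
exact: (Foo k).2.
Qed.

HB.instance Definition _ := Measure_isSigmaFinite.Build _ _ _ leb_step
  leb_step_sigma_finite.

End step.

Fixpoint lebesgue_rV n : {sigma_finite_measure set 'rV[R]_n -> \bar R} :=
  match n with
  | 0%N => \d_(0 : 'rV[R]_0)
  | n'.+1 => leb_step (lebesgue_rV n')
  end.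

End lebesgue_rV.

Section exponential_polynomials.
Variables (R : realType) (d : nat).
Implicit Types (g p : 'rV[R]_d -> R[i]) (f : functional R d).

Definition cexp (z : R[i]) : R[i] :=
  (expR (Re z) * cos (Im z)) +i* (expR (Re z) * sin (Im z)).

(* bilinear, without conjugation *)
Definition cpairing (lambda : 'rV[R[i]]_d) (x : 'rV[R]_d) : R[i] :=
  \sum_(j < d) lambda ord0 j * (x ord0 j)%:C.

Definition poly_eval (P : mpoly.mpoly d R[i]) (x : 'rV[R]_d) : R[i] :=
  mpoly.meval (fun j => (x ord0 j)%:C) P.

Definition exponential_polynomial p :=
  exists m (P : 'I_m -> mpoly.mpoly d R[i]) (lambda : 'I_m -> 'rV[R[i]]_d),
    forall x,
      p x = \sum_(k < m) poly_eval (P k) x * cexp (cpairing (lambda k) x).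

Definition locally_integrable_C g :=
  [/\ measurable_fun setT (fun x => Re (g x)),
      measurable_fun setT (fun x => Im (g x)) &
      forall K, compact K ->
        (lebesgue_rV d).-integrable K (fun x => (Re (g x))%:E) /\
        (lebesgue_rV d).-integrable K (fun x => (Im (g x))%:E)].

Definition integral_C g : R[i] :=
  Rintegral (lebesgue_rV d) setT (fun x => Re (g x)) +i*
  Rintegral (lebesgue_rV d) setT (fun x => Im (g x)).

Definition is_distribution_of g f :=
  locally_integrable_C g /\
  forall phi : testfun R d, f phi = integral_C (fun x => g x * phi x).

End exponential_polynomials.

(* Main.v *)
Require Import Defs.
From HB Require Import structures.
From mathcomp Require Import all_boot all_order all_algebra.
From mathcomp Require Import all_classical all_reals all_analysis.
From mathcomp Require complex mpoly.
From mathcomp Require Import measurable_realfun ring lra.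

Set Implicit Arguments.
Unset Strict Implicit.
Unset Printing Implicit Defensive.

Import Order.TTheory GRing.Theory Num.Theory.
Import numFieldNormedType.Exports.
Import complex.

Local Open Scope classical_set_scope.
Local Open Scope ring_scope.

(** Each dimension hypothesis is a linear recurrence satisfied by the
    translates of [f] along [h i].  Hence finitely many of the translates by
    nonnegative combinations of the [h i] have a span that is stable under
    all the translations [tau (h i)] ([invariant_family]).  Choosing test
    functions on which this span is faithfully evaluated ([dual_system]) turns
    it into coordinates: a row vector F of distributions and dual test
    functions Phi_j with F(Phi_j) = e_j, such that [f] is a linear combination
    of the entries of F.

    The vectors x for which there is a matrix C(x) with
    F(phi(. - x)) = F(phi) C(x) for every phi form a subgroup, which contains
    all the [h i].  They also form a closed set, because x |-> G(phi(. - x)) is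
    continuous for every distribution G.  By density every x qualifies
    ([translates_linearly_dense]), and C(x + y) = C(x) C(y).  The maps
    x |-> G(phi(. - x)) are even smooth ([orbit_smooth]), so along each axis C
    solves a linear system E' = E A with constant coefficients; the
    Cayley-Hamilton theorem reduces it to scalar equations u' = lambda u + v,
    and the entries of C are exponential polynomials ([exp_poly1_mx_ode],
    [exp_poly_mx_hom]).

    It remains to see that F is integration against entries of C.  Twisting by
    C(-x) undoes the action of translations: the functionals
    T_i(phi) = sum_j F_j(C(-x)_{ji} phi) vanish on all partial derivatives of
    test functions, and a linear functional with this property is a multiple
    of the Lebesgue integral ([derivation_invariant_integral]).  Untwisting,
    F_j(phi) = sum_i T_i(C(x)_{ij} phi) = sum_i v_i int C(x)_{ij} phi(x) dx,
    which exhibits [f] as integration against an exponential polynomial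
    ([exp_poly_density]).

    The statement on the integral is proved by induction on the dimension.  A
    test function whose integral over every line in the first direction
    vanishes is the derivative of a test function in that direction, so T only
    depends on the partial integral of phi in the first variable, and this
    gives a functional on one variable less.  The cut-off function that this
    reduction needs is a slice of any test function with a nonzero integral
    over some line; if there is none then T = 0.

    Estimates for real functions rest on the mean value theorem and on bounds
    of higher derivatives, which test functions have globally. *)

(** * Directional derivatives and quantitative remainders *)
Section directional.
Variables (R : realType) (V : normedModType R).
Implicit Types (u w : V -> R) (x v : V).

Lemma is_derive_line u x v t : derivable u (x + t *: v) v ->
  is_derive t 1 (fun t => u (x + t *: v)) ('D_v u (x + t *: v)).
Proof.
move=> du.
have e : (fun h : R => h^-1 *: (((fun t => u (x + t *: v)) \o shift t) (h *: 1)
    - u (x + t *: v))) =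
  (fun h => h^-1 *: ((u \o shift (x + t *: v)) (h *: v) - u (x + t *: v))).
  apply/funext => h /=; congr (_ *: (u _ - _)).
  by rewrite [_ *: 1]mulr1 scalerDl addrCA addrA.
have [du' du''] : is_derive (x + t *: v) v u ('D_v u (x + t *: v)).
  exact: derivableP.
split; first by rewrite /derivable e.
by rewrite /derive e.
Qed.

(** A quadratic remainder identifies the derivative.  All derivatives of
    integrals and of functionals below are computed in this form, where a
    bound on a second derivative replaces a uniform continuity argument. *)
Lemma is_derive_quadratic u x v (l M : R) :
  (forall h, `|h| <= 1 -> `|u (x + h *: v) - u x - h * l| <= M * h ^+ 2) ->
  is_derive x v u l.
Proof.
move=> H.
suff C : h^-1 *: ((u \o shift x) (h *: v) - u x) @[h --> 0^'] --> l.
  by split; [apply/cvg_ex; exists l | exact/cvg_lim].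
apply/cvgrPdist_le => e e0; near=> h.
have h0 : h != 0 by near: h; exact: nbhs_dnbhs_neq.
have h1 : `|h| <= 1.
  near: h; apply: dnbhs0_le; exact: ltr01.
have hM : `|h| <= e / (`|M| + 1).
  by near: h; apply: dnbhs0_le; rewrite divr_gt0// ltr_pwDr.
have := H h h1; rewrite /= [h *: v + x]addrC => Hh.
have -> : l - h^-1 *: (u (x + h *: v) - u x) =
    - (h^-1 * (u (x + h *: v) - u x - h * l)).
  by rewrite /GRing.scale/=; field.
rewrite normrN normrM normfV ler_pdivrMl ?normr_gt0//.
apply: (le_trans Hh); apply: (@le_trans _ _ (`|M| * h ^+ 2)).
  by rewrite ler_wpM2r ?sqr_ge0// ler_norm.
rewrite -real_normK ?num_real// expr2 mulrA [leRHS]mulrC ler_wpM2r//.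
move: hM; rewrite ler_pdivlMr ?ltr_pwDr// => hM.
by apply: le_trans hM; rewrite mulrC ler_wpM2l// lerDl.
Unshelve. all: by end_near. Qed.

Section along.
Variables (u : V -> R) (v : V).
Hypothesis du : forall x, derivable u x v.

Lemma derive_mvt x (h : R) : exists2 t, `|t| <= `|h| &
  u (x + h *: v) - u x = h * 'D_v u (x + t *: v).
Proof.
have dl (t : R) : is_derive t 1 (fun t => u (x + t *: v)) ('D_v u (x + t *: v)).
  exact: is_derive_line.
have cl : continuous (fun t : R => u (x + t *: v)).
  move=> t; apply: differentiable_continuous; apply/derivable1_diffP.
  by have [] := dl t.
have [h0|h0] := leP 0 h.
  have [|c /[!in_itv]/= /andP[c0 c1]] := MVT_segment h0 (fun t _ => dl t).
    exact: continuous_subspaceT.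
  rewrite scale0r addr0 subr0 => ->; exists c; last by rewrite mulrC.
  by rewrite !ger0_norm// (le_trans c0).
have [|c /[!in_itv]/= /andP[c0 c1]] := MVT_segment (ltW h0) (fun t _ => dl t).
  exact: continuous_subspaceT.
rewrite scale0r addr0 sub0r mulrN => e.
exists c; last by rewrite -opprB e opprK mulrC.
by rewrite !ler0_norm ?lerN2// ltW.
Qed.

Lemma derive_lipschitz (M : R) x h : (forall y, `|'D_v u y| <= M) ->
  `|u (x + h *: v) - u x| <= M * `|h|.
Proof.
by move=> HM; have [t _ ->] := derive_mvt x h; rewrite normrM mulrC ler_wpM2r.
Qed.

End along.

Lemma derive_taylor u v (M : R) x h :
  (forall x, derivable u x v) -> (forall x, derivable ('D_v u) x v) ->
  (forall y, `|'D_v ('D_v u) y| <= M) ->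
  `|u (x + h *: v) - u x - h * 'D_v u x| <= M * h ^+ 2.
Proof.
move=> du ddu HM; have [t th ->] := derive_mvt du x h.
rewrite -mulrBr normrM -real_normK ?num_real// expr2 mulrCA ler_wpM2l//.
apply: (le_trans (derive_lipschitz ddu x t HM)).
by rewrite ler_wpM2l// (le_trans _ (HM x)).
Qed.

End directional.

(** * Smooth functions and test functions with real values *)
Section smooth_functions.
Variables (R : realType) (d : nat).
Implicit Types (u w : 'rV[R]_d -> R) (s : seq 'I_d) (j : 'I_d).
Local Notation e_ j := (delta_mx 0 j : 'rV[R]_d).

Lemma partials_rcons s j u : partials (rcons s j) u = partials s ('D_(e_ j) u).
Proof. by rewrite /partials foldr_rcons. Qed.

Lemma smooth_continuous u : smooth u -> continuous u.
Proof. by move=> /(_ [::])[]. Qed.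

Lemma smooth_derivable u j x : smooth u -> derivable u x (e_ j).
Proof. by move=> /(_ [::])[_]; exact. Qed.
Arguments smooth_derivable : clear implicits.
Arguments smooth_derivable {u}.

Lemma smooth_derive u j : smooth u -> smooth ('D_(e_ j) u).
Proof. by move=> su s; have := su (rcons s j); rewrite partials_rcons. Qed.
Arguments smooth_derive {u}.

(** Smoothness as a greatest fixed point: the derivative that comes last in
    the list is taken first, so a class of continuous functions that is stable
    under first-order partial derivatives consists of smooth functions. *)
Lemma smooth_coind (P : set ('rV[R]_d -> R)) :
  (forall u, P u -> continuous u /\
     forall j, (forall x, derivable u x (e_ j)) /\ P ('D_(e_ j) u)) ->
  forall u, P u -> smooth u.
Proof.
move=> HP u Pu s; elim/last_ind: s u Pu => [|s j IH] u Pu.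
  by have [cu du] := HP u Pu; split => // j x; exact: (du j).1.
by rewrite partials_rcons; apply: IH; exact: ((HP u Pu).2 j).2.
Qed.

Lemma smooth_cst (c : R) : smooth (fun _ : 'rV[R]_d => c).
Proof.
apply: (@smooth_coind [set u | exists c, u = fun=> c]); last by exists c.
move=> _ [{}c ->]; split=> [x|j]; first exact: cst_continuous.
split=> [x|]; first exact: derivable_cst.
by exists 0; apply/funext => x; rewrite derive_cst.
Qed.

Lemma smoothN u : smooth u -> smooth (fun x => - u x).
Proof.
move=> su; have -> : (fun x => - u x) = -1 \*: u.
  by apply/funext => x /=; rewrite scaleN1r.
exact: smoothZ.
Qed.

Lemma smoothB u w : smooth u -> smooth w -> smooth (fun x => u x - w x).
Proof. by move=> su sw; apply: (smoothD su); exact: smoothN. Qed.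

(** The products of two smooth functions are not stable under derivation, but
    their finite sums are. *)
Inductive sum_of_products : ('rV[R]_d -> R) -> Prop :=
| sum_of_products1 u w : smooth u -> smooth w ->
    sum_of_products (fun x => u x * w x)
| sum_of_productsD u w : sum_of_products u -> sum_of_products w ->
    sum_of_products (u \+ w).

Lemma smoothM u w : smooth u -> smooth w -> smooth (fun x => u x * w x).
Proof.
move=> su sw; apply: (@smooth_coind sum_of_products); last exact: sum_of_products1.
move=> {u w su sw} v; elim => {v} [u w su sw|u w _ [cu du] _ [cw dw]].
  split=> [x|j].
    by apply: continuousM; exact: smooth_continuous.
  split=> [x|]; first by apply: derivableM; exact: smooth_derivable.
  have -> : 'D_(e_ j) (fun x => u x * w x) =
      (fun x => u x * 'D_(e_ j) w x) \+ (fun x => w x * 'D_(e_ j) u x).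
    apply/funext => x; rewrite [LHS]deriveM//; exact: smooth_derivable.
  exact: (sum_of_productsD (sum_of_products1 su (smooth_derive j sw))
    (sum_of_products1 sw (smooth_derive j su))).
split=> [x|j]; first by apply: continuousD; [exact: cu|exact: cw].
split=> [x|]; first by apply: derivableD; [exact: (du j).1|exact: (dw j).1].
have -> : 'D_(e_ j) (u \+ w) = 'D_(e_ j) u \+ 'D_(e_ j) w.
  by apply/funext => x; rewrite deriveD//; [exact: (du j).1|exact: (dw j).1].
exact: (sum_of_productsD (du j).2 (dw j).2).
Qed.

(** Compactness of the support, in the form that norm estimates use; see
    [test_function_real_test]. *)
Definition bounded_supp u := exists M : R, forall x, u x != 0 -> `|x| <= M.

Definition real_test u := smooth u /\ bounded_supp u.

Lemma real_test_derive u j : real_test u -> real_test ('D_(e_ j) u).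
Proof.
move=> [su [M uM]]; split; first exact: smooth_derive.
exists M => x; apply: contraNT; rewrite -ltNge => Mx.
have nx : \forall y \near x, u y = cst 0 y.
  have : \forall y \near x, M < `|y|.
    have : (fun y : 'rV[R]_d => `|y|) y @[y --> x] --> `|x|.
      exact: norm_continuous.
    move=> /cvgr_gt /(_ _ Mx); exact.
  apply: filterS => y My; apply/eqP; apply: contraTT My => /uM.
  by rewrite -leNgt.
by rewrite (near_eq_derive _ nx) derive_cst.
Qed.

Lemma real_test_partials u s : real_test u -> real_test (partials s u).
Proof.
by move=> ru; elim: s => [//|j s IH]; exact: (real_test_derive j IH).
Qed.

Lemma closed_ball_compact (M : R) : compact [set x : 'rV[R]_d | `|x| <= M].
Proof.
apply: bounded_closed_compact.
  exists M; split; first exact: num_real.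
  by move=> y My x /= xM; rewrite (le_trans xM)// ltW.
have -> : [set x : 'rV[R]_d | `|x| <= M] = (fun x => `|x|) @^-1` [set r | r <= M].
  by [].
apply: closed_comp; last exact: closed_le.
by move=> x _; exact: norm_continuous.
Qed.

Lemma continuous_bounded_supp u : continuous u -> bounded_supp u ->
  exists B : R, forall x, `|u x| <= B.
Proof.
move=> cu [M uM].
have := continuous_compact (continuous_subspaceT cu) (@closed_ball_compact M).
move=> /compact_bounded [B [_ HB]].
exists (`|B| + 1) => x; have [->|ux] := eqVneq (u x) 0.
  by rewrite normr0 addr_ge0.
by apply: HB; [rewrite ltr_pwDr// ler_norm|exists x => //; exact: uM].
Qed.

Lemma real_test_bounded u : real_test u -> exists B : R, forall x, `|u x| <= B.
Proof. by move=> [su]; apply: continuous_bounded_supp; exact: smooth_continuous. Qed.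

(** By induction on the order, applied to the finitely many first-order
    derivatives: there are only finitely many derivatives of order at most N. *)
Lemma real_test_partials_bounded N u : real_test u ->
  exists B : R, forall s, (size s <= N)%N -> forall x, `|partials s u x| <= B.
Proof.
elim: N u => [|N IH] u ru.
  have [B HB] := real_test_bounded ru; exists B => s.
  by rewrite leqn0 => /nilP ->.
have /choice[B HB] j : exists B : R, forall s, (size s <= N)%N ->
    forall x, `|partials s ('D_(e_ j) u) x| <= B.
  exact/IH/real_test_derive.
have [B0 HB0] := real_test_bounded ru.
exists (`|B0| + \sum_j `|B j|) => s; elim/last_ind: s => [_ x|s j _].
  by rewrite (le_trans (HB0 x))// (le_trans (ler_norm _))// lerDl sumr_ge0.
rewrite size_rcons ltnS partials_rcons => sN x.
rewrite (le_trans (HB j s sN x))// (le_trans (ler_norm _))//.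
by rewrite (bigD1 j)//= addrCA lerDl addr_ge0// sumr_ge0.
Qed.

(** Move from x to x + a one coordinate at a time. *)
Lemma real_test_lipschitz u : real_test u ->
  exists B : R, forall x a, `|u (x + a) - u x| <= B * \sum_j `|a ord0 j|.
Proof.
move=> ru; have [B HB] := real_test_partials_bounded 1 ru.
exists B => x a; rewrite [a in u (x + a)]row_sum_delta.
have : forall r : seq 'I_d, `|u (x + \sum_(j <- r) a ord0 j *: e_ j) - u x| <=
    B * \sum_(j <- r) `|a ord0 j|.
  elim=> [|j r IH]; first by rewrite !big_nil addr0 subrr normr0 mulr0.
  rewrite !big_cons addrCA mulrDr.
  have := derive_lipschitz (fun y => smooth_derivable j y ru.1)
    (x + \sum_(j <- r) a ord0 j *: e_ j) (a ord0 j) (HB [:: j] isT).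
  rewrite [x + \sum_(_ <- _) _ + _]addrC => H.
  by rewrite -(subrKA (u (x + \sum_(j <- r) a ord0 j *: e_ j)))
    (le_trans (ler_normD _ _))// lerD.
exact.
Qed.

(** The second difference quotient is symmetric in i and j, and it approaches
    the mixed derivative at the rate given by a bound on the third
    derivatives; comparing the two orders gives [derive_swap]. *)
Lemma second_difference u i j : real_test u -> exists M : R, forall x h, h != 0 ->
  `|(u (x + h *: e_ i + h *: e_ j) - u (x + h *: e_ j) - (u (x + h *: e_ i) - u x))
      / h ^+ 2
    - 'D_(e_ i) ('D_(e_ j) u) x| <= M * `|h|.
Proof.
move=> ru; have [B HB] := real_test_partials_bounded 3 ru.
have B0 : 0 <= B by rewrite (le_trans _ (HB [::] isT 0)).
have su := ru.1.
exists (B + B) => x h h0.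
(* w is the first difference in direction i; the remainder of its Taylor
   expansion in direction j is small as its second derivative is O(h). *)
pose w y := u (y + h *: e_ i) - u y.
have sw : smooth w.
  exact: (smoothB (smooth_shift (h *: e_ i) su) su).
have dw1 y : 'D_(e_ j) w y = 'D_(e_ j) u (y + h *: e_ i) - 'D_(e_ j) u y.
  have := partials_shift [:: j] u (h *: e_ i).
  move=> /(congr1 (fun f => f y)) /= <-; rewrite -deriveB//.
    exact: (smooth_derivable j y (smooth_shift (h *: e_ i) su)).
  exact: smooth_derivable.
have dw2 y : 'D_(e_ j) ('D_(e_ j) w) y =
    'D_(e_ j) ('D_(e_ j) u) (y + h *: e_ i) - 'D_(e_ j) ('D_(e_ j) u) y.
  rewrite (funext dw1).
  have := partials_shift [:: j] ('D_(e_ j) u) (h *: e_ i).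
  move=> /(congr1 (fun f => f y)) /= <-; rewrite -deriveB//.
    exact: (smooth_derivable j y (smooth_shift (h *: e_ i) (smooth_derive j su))).
  exact: (smooth_derivable j y (smooth_derive j su)).
have H1 : `|w (x + h *: e_ j) - w x - h * 'D_(e_ j) w x| <= (B * `|h|) * h ^+ 2.
  apply: derive_taylor => y.
  - exact: smooth_derivable.
  - by apply: smooth_derivable; exact: smooth_derive.
  - have sjj := smooth_derive j (smooth_derive j su).
    have := derive_lipschitz (fun z => smooth_derivable i z sjj) y h
      (HB [:: i; j; j] isT).
    by rewrite dw2.
have H2 : `|'D_(e_ j) u (x + h *: e_ i) - 'D_(e_ j) u x
    - h * 'D_(e_ i) ('D_(e_ j) u) x| <= B * h ^+ 2.
  have sj := smooth_derive j su; have sij := smooth_derive i sj.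
  exact: (derive_taylor x h (fun y => smooth_derivable i y sj)
    (fun y => smooth_derivable i y sij) (HB [:: i; i; j] isT)).
have h2 : 0 < h ^+ 2 by rewrite exprn_even_gt0.
have -> : x + h *: e_ i + h *: e_ j = x + h *: e_ j + h *: e_ i by rewrite addrAC.
rewrite -[X in (X - _) / _]/(w (x + h *: e_ j)) -[X in (_ - X) / _]/(w x).
rewrite -(ler_pM2r h2) -[X in _ * X <= _](gtr0_norm h2) -normrM mulrBl.
rewrite divfK ?gt_eqF//.
have -> : w (x + h *: e_ j) - w x - 'D_(e_ i) ('D_(e_ j) u) x * h ^+ 2 =
   (w (x + h *: e_ j) - w x - h * 'D_(e_ j) w x) +
   h * ('D_(e_ j) w x - h * 'D_(e_ i) ('D_(e_ j) u) x) by ring.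
rewrite (le_trans (ler_normD _ _))// mulrDl mulrDl lerD//.
rewrite normrM dw1 mulrAC mulrC ler_wpM2r//.
Qed.

Lemma derive_swap u i j : real_test u ->
  'D_(e_ i) ('D_(e_ j) u) = 'D_(e_ j) ('D_(e_ i) u).
Proof.
move=> ru; apply/funext => x.
have [M HM] := second_difference i j ru.
have [M' HM'] := second_difference j i ru.
apply/eqP; rewrite -subr_eq0 -normr_le0; apply/ler_addgt0Pr => e e0; rewrite add0r.
have Mp : 0 < `|M| + `|M'| + 1 by rewrite ltr_pwDr// addr_ge0.
pose h := e / (`|M| + `|M'| + 1).
have h0 : 0 < h by rewrite divr_gt0.
have := HM x h (lt0r_neq0 h0); have := HM' x h (lt0r_neq0 h0).
set a := _ / h ^+ 2; set b := _ / h ^+ 2.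
have -> : a = b.
  rewrite /a /b; congr (_ / _); rewrite [x + _ *: e_ j + _]addrAC; ring.
move=> H1 H2; rewrite -(subrKA b) (le_trans (ler_normD _ _))//.
rewrite distrC; apply: (le_trans (lerD H2 H1)).
rewrite -mulrDl gtr0_norm// /h mulrA ler_pdivrMr// mulrC ler_wpM2l// ?ltW//.
by rewrite ltr_pwDr// lerD// ler_norm.
Qed.

Lemma partials_derive u s j : real_test u ->
  partials s ('D_(e_ j) u) = 'D_(e_ j) (partials s u).
Proof.
move=> ru; elim: s => [//|i s IH] /=.
by rewrite IH; exact: (derive_swap i j (real_test_partials s ru)).
Qed.

Lemma real_testD u w : real_test u -> real_test w -> real_test (u \+ w).
Proof.
move=> [su [M uM]] [sw [M' wM]]; split; first exact: smoothD.
exists (Num.max M M') => x; rewrite le_max /=.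
have [->|/uM-> //] := eqVneq (u x) 0.
by rewrite add0r => /wM ->; rewrite orbT.
Qed.

Lemma real_testM u w : smooth u -> real_test w -> real_test (fun x => u x * w x).
Proof.
move=> su [sw [M wM]]; split; first exact: smoothM.
by exists M => x; rewrite mulf_eq0 negb_or => /andP[_ /wM].
Qed.

Lemma real_testZ (c : R) w : real_test w -> real_test (fun x => c * w x).
Proof. by apply: real_testM; exact: smooth_cst. Qed.

End smooth_functions.
Arguments smooth_derivable {R d u} j x _.
Arguments smooth_derive {R d u} j _.

(** * Complex-valued functions *)
Section complex_numbers.
Variable R : realType.
Local Open Scope complex_scope.
Local Notation normc := ComplexField.Normc.normc.
Implicit Types z w : R[i].

Lemma creD z w : Re (z + w) = Re z + Re w. Proof. by case: z; case: w. Qed.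
Lemma cimD z w : Im (z + w) = Im z + Im w. Proof. by case: z; case: w. Qed.
Lemma creN z : Re (- z) = - Re z. Proof. by case: z. Qed.
Lemma cimN z : Im (- z) = - Im z. Proof. by case: z. Qed.
Lemma creM z w : Re (z * w) = Re z * Re w - Im z * Im w.
Proof. by case: z; case: w. Qed.
Lemma cimM z w : Im (z * w) = Re z * Im w + Im z * Re w.
Proof. by case: z => a b; case: w => c e /=; rewrite [_ * c]mulrC. Qed.
Lemma eq_ReIm z w : Re z = Re w -> Im z = Im w -> z = w.
Proof. by case: z => a b; case: w => a' b' /= -> ->. Qed.

Lemma normc_ge0 z : 0 <= normc z.
Proof. by case: z => a b; exact: sqrtr_ge0. Qed.

Lemma Re_le_normc z : `|Re z| <= normc z.
Proof.
by case: z => a b /=; rewrite -sqrtr_sqr ler_wsqrtr// lerDl sqr_ge0.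
Qed.

Lemma Im_le_normc z : `|Im z| <= normc z.
Proof.
by case: z => a b /=; rewrite -sqrtr_sqr ler_wsqrtr// lerDr sqr_ge0.
Qed.

Lemma normc_le z : normc z <= `|Re z| + `|Im z|.
Proof.
case: z => a b /=.
rewrite -(@ler_pXn2r _ 2) ?nnegrE ?sqrtr_ge0 ?addr_ge0//.
rewrite sqr_sqrtr ?addr_ge0 ?sqr_ge0// sqrrD !real_normK ?num_real//.
by rewrite addrAC lerDl mulrn_wge0// mulr_ge0.
Qed.

Lemma normc_sum I (r : seq I) (F : I -> R[i]) :
  normc (\sum_(i <- r) F i) <= \sum_(i <- r) normc (F i).
Proof.
elim: r => [|i r IH]; first by rewrite !big_nil /= expr0n /= addr0 sqrtr0.
rewrite !big_cons; apply: (le_trans (le_normcD _ _)).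
by rewrite lerD2l.
Qed.

End complex_numbers.

Section test_functions.
Variables (R : realType) (d : nat).
Local Open Scope complex_scope.
Local Notation normc := ComplexField.Normc.normc.
Local Notation e_ j := (delta_mx 0 j : 'rV[R]_d).
Implicit Types (phi psi : testfun R d) (j : 'I_d) (s : seq 'I_d).

Lemma test_function_real_test (g : 'rV[R]_d -> R[i]) :
  g \in @test_function R d <->
  real_test (fun x => Re (g x)) /\ real_test (fun x => Im (g x)).
Proof.
split=> [/test_functionP[[rg ig] cg]|[[rg [M HM]] [ig [M' HM']]]].
  have [B [_ HB]] := compact_bounded cg.
  have sg x : g x != 0 -> `|x| <= `|B| + 1.
    move=> gx; apply: HB; first by rewrite ltr_pwDr// ler_norm.
    exact: subset_closure.
  by split; split => //; exists (`|B| + 1) => x gx; apply: sg;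
    apply: contraNneq gx => ->.
apply/test_functionP; split; first by [].
apply: (supp_compact_sub (@closed_ball_compact R d (Num.max M M'))) => x.
apply: contraNT => /= xM; apply/eqP/eq_ReIm; apply/eqP; apply: contraNT xM.
  by move=> /HM xM; rewrite le_max xM.
by move=> /HM' xM; rewrite le_max xM orbT.
Qed.

Lemma testfun_real_test phi :
  real_test (fun x => Re (phi x)) /\ real_test (fun x => Im (phi x)).
Proof. exact/test_function_real_test/testfunP. Qed.

Lemma testfun_ext phi psi : (forall x, phi x = psi x) -> phi = psi.
Proof. by move=> e; apply/val_inj/funext. Qed.

Definition cderive j (g : 'rV[R]_d -> R[i]) x : R[i] :=
  'D_(e_ j) (fun y => Re (g y)) x +i* 'D_(e_ j) (fun y => Im (g y)) x.

Lemma test_function_derive j phi : cderive j phi \in @test_function R d.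
Proof.
by apply/test_function_real_test; have [rp ip] := testfun_real_test phi;
  split; exact: real_test_derive.
Qed.

Definition testfun_derive j phi := TestFun (test_function_derive j phi).

Lemma test_functionM (c : 'rV[R]_d -> R[i]) phi : csmooth c ->
  (fun x => c x * phi x) \in @test_function R d.
Proof.
move=> [rc ic]; have [rp ip] := testfun_real_test phi.
apply/test_function_real_test; split.
  have -> : (fun x => Re (c x * phi x)) =
      (fun x => Re (c x) * Re (phi x)) \+ (fun x => - Im (c x) * Im (phi x)).
    by apply/funext => x; rewrite creM /= mulNr.
  exact: (real_testD (real_testM rc rp) (real_testM (smoothN ic) ip)).
have -> : (fun x => Im (c x * phi x)) =
    (fun x => Re (c x) * Im (phi x)) \+ (fun x => Im (c x) * Re (phi x)).
  by apply/funext => x; rewrite cimM.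
exact: (real_testD (real_testM rc ip) (real_testM ic rp)).
Qed.

Definition testfunM (c : 'rV[R]_d -> R[i]) (sc : csmooth c) phi :=
  TestFun (test_functionM phi sc).

Lemma cderiveM j (g k : 'rV[R]_d -> R[i]) x : csmooth g -> csmooth k ->
  cderive j (fun x => g x * k x) x = cderive j g x * k x + g x * cderive j k x.
Proof.
move=> [rg ig] [rk ik]; have dM (u w : 'rV[R]_d -> R) : smooth u -> smooth w ->
    derivable (fun x => u x * w x) x (e_ j) /\
    'D_(e_ j) (fun x => u x * w x) x =
      u x * 'D_(e_ j) w x + w x * 'D_(e_ j) u x.
  move=> su sw; split; first by apply: derivableM; exact: smooth_derivable.
  by rewrite [LHS]deriveM//; exact: smooth_derivable.
apply: eq_ReIm.
  rewrite creD !creM /= (_ : (fun y => _) = (fun y => Re (g y) * Re (k y)) \-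
    (fun y => Im (g y) * Im (k y))); last by apply/funext => y; rewrite creM.
  rewrite deriveB; [|exact: (dM _ _ rg rk).1|exact: (dM _ _ ig ik).1].
  rewrite (dM _ _ rg rk).2 (dM _ _ ig ik).2; ring.
rewrite cimD !cimM /= (_ : (fun y => _) = (fun y => Re (g y) * Im (k y)) \+
  (fun y => Im (g y) * Re (k y))); last by apply/funext => y; rewrite cimM.
rewrite deriveD; [|exact: (dM _ _ rg ik).1|exact: (dM _ _ ig rk).1].
rewrite (dM _ _ rg ik).2 (dM _ _ ig rk).2; ring.
Qed.

Lemma csmooth_testfun phi : csmooth phi.
Proof. by have [[rp _] [ip _]] := testfun_real_test phi. Qed.

Lemma csmoothM (g k : 'rV[R]_d -> R[i]) : csmooth g -> csmooth k ->
  csmooth (fun x => g x * k x).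
Proof.
move=> [rg ig] [rk ik]; split.
  rewrite (_ : (fun y => _) = fun y => Re (g y) * Re (k y) -
    Im (g y) * Im (k y)); last by apply/funext => y; rewrite creM.
  by apply: smoothB; exact: smoothM.
rewrite (_ : (fun y => _) = (fun y => Re (g y) * Im (k y)) \+
  (fun y => Im (g y) * Re (k y))); last by apply/funext => y; rewrite cimM.
by apply: smoothD; exact: smoothM.
Qed.

Lemma csmooth_cst (c : R[i]) : csmooth (fun _ : 'rV[R]_d => c).
Proof. by split; exact: smooth_cst. Qed.

Lemma csmoothD (g k : 'rV[R]_d -> R[i]) : csmooth g -> csmooth k ->
  csmooth (fun x => g x + k x).
Proof.
move=> [rg ig] [rk ik]; split.
  rewrite (_ : (fun y => _) = (fun y => Re (g y)) \+ (fun y => Re (k y))).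
    exact: smoothD.
  by apply/funext => y; rewrite creD.
rewrite (_ : (fun y => _) = (fun y => Im (g y)) \+ (fun y => Im (k y))).
  exact: smoothD.
by apply/funext => y; rewrite cimD.
Qed.

Lemma csmooth_sum I (r : seq I) (g : I -> 'rV[R]_d -> R[i]) :
  (forall i, csmooth (g i)) -> csmooth (fun x => \sum_(i <- r) g i x).
Proof.
move=> sg; elim: r => [|i r IH].
  rewrite (_ : (fun x => _) = fun=> 0); first exact: csmooth_cst.
  by apply/funext => x; rewrite big_nil.
rewrite (_ : (fun x => _) = fun x => g i x + \sum_(i <- r) g i x).
  exact: csmoothD.
by apply/funext => x; rewrite big_cons.
Qed.

End test_functions.

(** * Translates of test functions and continuity of distributions *)
Section translates.
Variables (R : realType) (d : nat).
Local Open Scope complex_scope.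
Local Notation normc := ComplexField.Normc.normc.
Local Notation e_ j := (delta_mx 0 j : 'rV[R]_d).
Implicit Types (phi psi : testfun R d) (j : 'I_d) (s : seq 'I_d).

Definition translate (x : 'rV[R]_d) phi : testfun R d := testfun_shift (- x) phi.

Lemma translateE x phi y : translate x phi y = phi (y - x).
Proof. by []. Qed.

Lemma translate0 phi : translate 0 phi = phi.
Proof. by apply: testfun_ext => x; rewrite translateE subr0. Qed.

Lemma translateD x y phi : translate (x + y) phi = translate x (translate y phi).
Proof. by apply: testfun_ext => z; rewrite !translateE opprD addrA. Qed.

Lemma translate_derive x j phi :
  testfun_derive j (translate x phi) = translate x (testfun_derive j phi).
Proof.
apply: testfun_ext => y; rewrite translateE /= /cderive.
have H := fun u => congr1 (@^~ y) (@partials_shift R d [:: j] u (- x)).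
by congr (_ +i* _); [exact: (H (fun y => Re (phi y)))|exact: (H (fun y => Im (phi y)))].
Qed.

Definition derivs_le N (M : R) phi := forall s, (size s <= N)%N -> forall x,
  `|partials s (fun x => Re (phi x)) x| <= M /\
  `|partials s (fun x => Im (phi x)) x| <= M.

(** Continuity of a linear functional, expressed with an arbitrary common
    majorant of the derivatives instead of their supremum: in this form
    stability under translations and finite combinations is immediate. *)
Definition bounded_linear (G : functional R d) :=
  (forall (c : R[i]) phi psi, G (c *: phi + psi) = c * G phi + G psi) /\
  forall K : R, exists C N, 0 <= C /\ forall phi (M : R),
    (forall x, phi x != 0 -> `|x| <= K) -> derivs_le N M phi ->
    normc (G phi) <= C * M.

(** The factor 2 passes from the moduli of real and imaginary parts to the
    modulus; the majorant bounds the supremum because the set of values of the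
    derivatives is nonempty. *)
Lemma is_distribution_bounded_linear (G : functional R d) :
  is_distribution G -> bounded_linear G.
Proof.
move=> dG; split=> [c phi psi|K]; first exact: dG.1.
have [C [N HC]] := dG.2 _ (@closed_ball_compact R d K).
exists (`|C| * 2), N; split=> [|phi M sphi HM]; first by rewrite mulr_ge0.
have M0 : 0 <= M by rewrite (le_trans _ (HM [::] isT 0).1).
apply: le_trans (HC phi _) _.
  rewrite /supp; have cl : closed [set x : 'rV[R]_d | `|x| <= K].
    by apply: compact_closed; [exact: norm_hausdorff|exact: closed_ball_compact].
  by have /closure_id -> := cl; apply: closureS.
pose S := [set normc (cpartials s phi x) |
  s in [set s : seq 'I_d | (size s <= N)%N] & x in [set: 'rV[R]_d]].
have S0 : S (normc (cpartials [::] phi 0)) by exists [::] => //; exists 0.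
have ubS : ubound S (M * 2).
  move=> _ [s sN [x _ <-]]; apply: le_trans (normc_le _) _.
  by rewrite mulr_natr mulr2n; apply: lerD; have [] := HM s sN x.
have sup0 : 0 <= testfun_norm N phi.
  apply: le_trans (ub_le_sup _ S0); first exact: normc_ge0.
  by exists (M * 2).
apply: (@le_trans _ _ (`|C| * testfun_norm N phi)).
  by rewrite ler_wpM2r// ler_norm.
rewrite -mulrA [2 * _]mulrC ler_wpM2l//; apply: ge_sup => //.
by exists (normc (cpartials [::] phi 0)).
Qed.

Section distribution.
Variable G : functional R d.
Hypothesis dG : bounded_linear G.

Lemma bounded_linearP (c : R[i]) phi psi : G (c *: phi + psi) = c * G phi + G psi.
Proof. exact: dG.1. Qed.

Lemma bounded_linearD phi psi : G (phi + psi) = G phi + G psi.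
Proof. by have := bounded_linearP 1 phi psi; rewrite scale1r mul1r. Qed.

Lemma bounded_linear0 : G 0 = 0.
Proof. by apply: (addrI (G 0)); rewrite -bounded_linearD !addr0. Qed.

Lemma bounded_linearZ (c : R[i]) phi : G (c *: phi) = c * G phi.
Proof. by have := bounded_linearP c phi 0; rewrite !addr0 bounded_linear0 addr0. Qed.

Lemma bounded_linearB phi psi : G (phi - psi) = G phi - G psi.
Proof. by rewrite bounded_linearD -scaleN1r bounded_linearZ mulN1r. Qed.

End distribution.

End translates.

(** * Smoothness of the orbit map of a distribution *)
Section orbit.
Variables (R : realType) (d : nat).
Local Open Scope complex_scope.
Local Notation normc := ComplexField.Normc.normc.
Local Notation e_ j := (delta_mx 0 j : 'rV[R]_d).
Implicit Types (phi psi : testfun R d) (j : 'I_d) (s : seq 'I_d).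

Lemma coord_le_norm (a : 'rV[R]_d) j : `|a ord0 j| <= `|a|.
Proof. by rewrite [leRHS]/Num.Def.normr/= mx_normrE; apply: (le_bigmax _ _ (ord0, j)). Qed.

Lemma locally_lipschitz_continuous (u : 'rV[R]_d -> R) x (L : R) :
  (forall a, `|a| <= 1 -> `|u (x + a) - u x| <= L * \sum_j `|a ord0 j|) ->
  {for x, continuous u}.
Proof.
move=> HL; have F : Filter (nbhs x) by exact: nbhs_filter.
apply/(@cvgrPdist_le _ _ _ (nbhs x) F) => e e0.
have Lp : 0 < `|L| * d%:R + 1 by rewrite ltr_wpDl// mulr_ge0.
have de : 0 < Num.min 1 (e / (`|L| * d%:R + 1)).
  by rewrite lt_min ltr01 divr_gt0.
have nx : \forall y \near x, `|x - y| <= Num.min 1 (e / (`|L| * d%:R + 1)).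
  have C : (fun y : 'rV[R]_d => y) y @[y --> x] --> x by exact: cvg_id.
  by move/cvgrPdist_le : C; exact.
near=> y.
have : `|x - y| <= Num.min 1 (e / (`|L| * d%:R + 1)).
  near: y; exact: nx.
rewrite le_min distrC => /andP[y1 ye].
have := HL (y - x) y1; rewrite [x + _]addrC subrK distrC => H; apply: (le_trans H).
apply: (@le_trans _ _ (`|L| * (d%:R * `|y - x|))).
  rewrite (le_trans (ler_wpM2r _ (ler_norm L))) ?sumr_ge0// ler_wpM2l//.
  apply: (@le_trans _ _ (\sum_(j < d) `|y - x|)).
    by apply: ler_sum => j _; exact: coord_le_norm.
  by rewrite sumr_const card_ord mulr_natl.
move: ye; rewrite ler_pdivlMr// => ye; apply: le_trans ye.
by rewrite mulrA mulrC ler_wpM2l// lerDl.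
Unshelve. all: by end_near. Qed.

Lemma partials_lin3 s (u v w : 'rV[R]_d -> R) (h : R) :
  smooth u -> smooth v -> smooth w ->
  partials s (fun z => u z - v z + h * w z) =
  fun z => partials s u z - partials s v z + h * partials s w z.
Proof.
move=> su sv sw.
have -> : (fun z => u z - v z + h * w z) = (u \+ ((-1) \*: v)) \+ (h \*: w).
  by apply/funext => z; rewrite /= scaleN1r.
have sv' : smooth (-1 \*: v) by exact: smoothZ.
have sw' : smooth (h \*: w) by exact: smoothZ.
rewrite (partialsD s (smoothD su sv') sw') (partialsD s su sv').
rewrite (partialsZ s (-1) sv) (partialsZ s h sw); apply/funext => z /=.
by rewrite scaleN1r.
Qed.

(** Convergence of difference quotients of translates, together with all
    derivatives.  The derivative in direction j has to be taken after the
    derivatives listed in s, which is where the symmetry of second derivatives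
    enters. *)
Lemma real_test_translate_taylor N (u : 'rV[R]_d -> R) j : real_test u ->
  exists M : R, forall s, (size s <= N)%N -> forall h y,
  `|partials s (fun z => u (z - h *: e_ j) - u z + h * 'D_(e_ j) u z) y|
    <= M * h ^+ 2.
Proof.
move=> ru; have [M HM] := real_test_partials_bounded N.+2 ru.
exists M => s sN h y.
rewrite partials_lin3; [|exact: (smooth_shift _ ru.1)|exact: ru.1|
  exact: (smooth_derive j ru.1)].
have -> := partials_shift s u (- (h *: e_ j)).
rewrite (partials_derive s j ru) -scaleNr -[h in _ + h * _]opprK mulNr.
have rs := real_test_partials s ru.
rewrite -(sqrrN h).
have sj := smooth_derive j rs.1.
have T := derive_taylor y (- h) (fun y => smooth_derivable j y rs.1)
  (fun y => smooth_derivable j y sj) (HM [:: j, j & s] sN).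
exact: T.
Qed.

Lemma real_test_translate_lipschitz N (u : 'rV[R]_d -> R) : real_test u ->
  exists M : R, forall s, (size s <= N)%N -> forall a y,
  `|partials s (fun z => u (z - a) - u z) y| <= M * \sum_j `|a ord0 j|.
Proof.
elim: N u => [|N IH] u ru.
  have [M HM] := real_test_lipschitz ru; exists M => s.
  rewrite leqn0 => /nilP -> a y /=; apply: le_trans (HM _ _) _.
  by rewrite (eq_bigr (fun j => `|a ord0 j|))// => j _; rewrite mxE normrN.
have /choice[M HM] j := IH _ (real_test_derive j ru).
have [M0 HM0] := real_test_lipschitz ru.
exists (`|M0| + \sum_j `|M j|) => s; elim/last_ind: s => [_ a y /=|s j _].
  apply: le_trans (HM0 _ _) _.
  rewrite (eq_bigr (fun j => `|a ord0 j|))//; last by move=> j _; rewrite mxE normrN.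
  rewrite ler_wpM2r ?sumr_ge0//.
  by rewrite (le_trans (ler_norm _))// lerDl sumr_ge0.
rewrite size_rcons ltnS => sN a y; rewrite partials_rcons.
have -> : 'D_(e_ j) (fun z => u (z - a) - u z) =
    fun z => 'D_(e_ j) u (z - a) - 'D_(e_ j) u z.
  apply/funext => z.
  have := partials_shift [:: j] u (- a) => /(congr1 (@^~ z)) /= <-.
  rewrite -deriveB//; last exact: (smooth_derivable j z ru.1).
  exact: (smooth_derivable j z (smooth_shift (- a) ru.1)).
apply: (le_trans (HM j s sN a y)).
rewrite ler_wpM2r ?sumr_ge0// (le_trans (ler_norm _))//.
by rewrite (bigD1 j)//= addrCA lerDl addr_ge0// sumr_ge0.
Qed.

Lemma creZr (h : R) (z : R[i]) : Re (h%:C * z) = h * Re z.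
Proof. by rewrite creM /= mul0r subr0. Qed.

Lemma cimZr (h : R) (z : R[i]) : Im (h%:C * z) = h * Im z.
Proof. by rewrite cimM /= mul0r addr0. Qed.

Variable G : functional R d.
Hypothesis dG : bounded_linear G.

Lemma testfun_bounded phi : exists K : R, forall x, phi x != 0 -> `|x| <= K.
Proof.
have [[_ [K HK]] [_ [K' HK']]] := testfun_real_test phi.
exists (Num.max K K') => x; apply: contraNT => xM.
apply/eqP/eq_ReIm; apply/eqP; apply: contraNT xM.
  by move=> /HK xM; rewrite le_max xM.
by move=> /HK' xM; rewrite le_max xM orbT.
Qed.

(** For |h| <= 1 all the functions involved are supported in a fixed ball, so
    the continuity of G applies with constants that do not depend on h. *)
Lemma translate_taylor j phi : exists M : R, forall h, `|h| <= 1 ->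
  normc (G (translate (h *: e_ j) phi) - G phi + h%:C * G (testfun_derive j phi))
    <= M * h ^+ 2.
Proof.
have [K HK] := testfun_bounded phi.
have [K' HK'] := testfun_bounded (testfun_derive j phi).
have [C [N [C0 HC]]] := dG.2 (Num.max (K + `|e_ j|) K').
have [rp ip] := testfun_real_test phi.
have [M HM] := real_test_translate_taylor N j rp.
have [M' HM'] := real_test_translate_taylor N j ip.
exists (C * Num.max M M') => h h1.
rewrite -(bounded_linearB dG) -(bounded_linearZ dG) -(bounded_linearD dG) -mulrA.
have vE x : (translate (h *: e_ j) phi - phi + h%:C *: testfun_derive j phi) x =
  phi (x - h *: e_ j) - phi x + h%:C * testfun_derive j phi x by [].
apply: HC => [x|s sN x].
  rewrite vE; apply: contraNT; rewrite le_max negb_or -!ltNge => /andP[xK xK'].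
  have -> : testfun_derive j phi x = 0.
    by apply/eqP; apply: contraTT xK' => /HK'; rewrite -leNgt.
  have -> : phi x = 0.
    apply/eqP; apply: contraTT xK => /HK xK; rewrite -leNgt (le_trans xK)//.
    by rewrite lerDl.
  have -> : phi (x - h *: e_ j) = 0.
    apply/eqP; apply: contraTT xK => /HK xK; rewrite -leNgt.
    rewrite -[x](subrK (h *: e_ j)) (le_trans (ler_normD _ _))// lerD//.
    by rewrite normrZ ler_piMl.
  by rewrite mulr0 subr0 addr0.
split.
  rewrite (_ : (fun x => _) = fun z => Re (phi (z - h *: e_ j)) - Re (phi z)
    + h * 'D_(e_ j) (fun y => Re (phi y)) z).
    by rewrite (le_trans (HM s sN h x))// ler_wpM2r ?sqr_ge0// le_max lexx.
  by apply/funext => z; rewrite vE !creD creN creZr.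
rewrite (_ : (fun x => _) = fun z => Im (phi (z - h *: e_ j)) - Im (phi z)
  + h * 'D_(e_ j) (fun y => Im (phi y)) z).
  by rewrite (le_trans (HM' s sN h x))// ler_wpM2r ?sqr_ge0// le_max lexx orbT.
by apply/funext => z; rewrite vE !cimD cimN cimZr.
Qed.

Lemma translate_lipschitz phi : exists L : R, forall a : 'rV[R]_d, `|a| <= 1 ->
  normc (G (translate a phi) - G phi) <= L * \sum_j `|a ord0 j|.
Proof.
have [K HK] := testfun_bounded phi.
have [C [N [C0 HC]]] := dG.2 (K + 1).
have [rp ip] := testfun_real_test phi.
have [M HM] := real_test_translate_lipschitz N rp.
have [M' HM'] := real_test_translate_lipschitz N ip.
exists (C * Num.max M M') => a a1.
rewrite -(bounded_linearB dG) -mulrA.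
have vE x : (translate a phi - phi) x = phi (x - a) - phi x by [].
apply: HC => [x|s sN x].
  rewrite vE; apply: contraNT; rewrite -ltNge => xK.
  have -> : phi x = 0.
    apply/eqP; apply: contraTT xK => /HK xK; rewrite -leNgt (le_trans xK)//.
    by rewrite lerDl.
  have -> : phi (x - a) = 0.
    apply/eqP; apply: contraTT xK => /HK xK; rewrite -leNgt.
    by rewrite -[x](subrK a) (le_trans (ler_normD _ _))// lerD.
  by rewrite subr0.
split.
  rewrite (_ : (fun x => _) = fun z => Re (phi (z - a)) - Re (phi z)).
    by rewrite (le_trans (HM s sN a x))// ler_wpM2r ?sumr_ge0// le_max lexx.
  by apply/funext => z; rewrite vE creD creN.
rewrite (_ : (fun x => _) = fun z => Im (phi (z - a)) - Im (phi z)).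
  by rewrite (le_trans (HM' s sN a x))// ler_wpM2r ?sumr_ge0// le_max lexx orbT.
by apply/funext => z; rewrite vE cimD cimN.
Qed.

Lemma translate_shift x y phi : translate (x + y) phi = translate y (translate x phi).
Proof. by rewrite addrC translateD. Qed.

Lemma orbit_is_derive j phi x :
  is_derive x (e_ j) (fun x => Re (G (translate x phi)))
    (Re (- G (translate x (testfun_derive j phi)))) /\
  is_derive x (e_ j) (fun x => Im (G (translate x phi)))
    (Im (- G (translate x (testfun_derive j phi)))).
Proof.
have [M HM] := translate_taylor j (translate x phi).
split; apply: (@is_derive_quadratic _ _ _ _ _ _ M) => h h1;
  apply: le_trans (HM h h1); rewrite translate_shift -translate_derive.
  by rewrite creN mulrN opprK -creN -creD -creZr -creD; exact: Re_le_normc.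
by rewrite cimN mulrN opprK -cimN -cimD -cimZr -cimD; exact: Im_le_normc.
Qed.

Lemma orbit_continuous phi :
  continuous (fun x => Re (G (translate x phi))) /\
  continuous (fun x => Im (G (translate x phi))).
Proof.
split=> x; have [L HL] := translate_lipschitz (translate x phi);
  apply: (@locally_lipschitz_continuous _ _ L) => a a1;
  apply: le_trans (HL a a1); rewrite translate_shift.
  by rewrite -creN -creD; exact: Re_le_normc.
by rewrite -cimN -cimD; exact: Im_le_normc.
Qed.

Lemma orbit_cderive j phi x : cderive j (fun x => G (translate x phi)) x =
  - G (translate x (testfun_derive j phi)).
Proof.
have [[_ rd] [_ id]] := orbit_is_derive j phi x.
by apply: eq_ReIm => /=.
Qed.

(** The derivative of an orbit map is again an orbit map, up to sign. *)
Lemma orbit_smooth phi : csmooth (fun x => G (translate x phi)).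
Proof.
have tN x psi : G (translate x (- psi)) = - G (translate x psi).
  rewrite (_ : translate x (- psi) = 0 - translate x psi) ?(bounded_linearB dG) ?(bounded_linear0 dG) ?sub0r//.
  by apply: testfun_ext.
split.
  apply: (@smooth_coind _ _ [set u | exists psi, u = fun x => Re (G (translate x psi))]);
    last by exists phi.
  move=> _ [psi ->]; split; first exact: (orbit_continuous psi).1.
  move=> j; split=> [x|].
    by have [[rd _] _] := orbit_is_derive j psi x.
  exists (- testfun_derive j psi); apply/funext => x; rewrite tN.
  by have [[_ rd] _] := orbit_is_derive j psi x.
apply: (@smooth_coind _ _ [set u | exists psi, u = fun x => Im (G (translate x psi))]);
  last by exists phi.
move=> _ [psi ->]; split; first exact: (orbit_continuous psi).2.
move=> j; split=> [x|].
  by have [_ [rd _]] := orbit_is_derive j psi x.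
exists (- testfun_derive j psi); apply/funext => x; rewrite tN.
by have [_ [_ rd]] := orbit_is_derive j psi x.
Qed.

End orbit.

(** * Integration of continuous functions on row vectors *)
Section measurable_rV.
Variables (R : realType) (n : nat).
Implicit Types (u : 'rV[R]_n -> R) (x : 'rV[R]_n).

Let box (q : 'rV[rat]_n) (k : nat) : set 'rV[R]_n :=
  [set y | forall i, `|ratr (q ord0 i) - y ord0 i| < k.+1%:R^-1].

Let measurable_box q k : measurable (box q k).
Proof.
have -> : box q k = \bigcap_(i in [set: 'I_n])
    (rV_coord i @^-1` [set r : R | `|ratr (q ord0 i) - r| < k.+1%:R^-1]).
  by apply/seteqP; split=> [y yq i _|y yq i]; [exact: yq|exact: yq].
apply: fin_bigcap_measurable => // i _.
rewrite -[X in measurable X]setTI; apply: (measurable_rV_coord i) => //.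
rewrite (_ : [set r : R | _] =
  [set` `]ratr (q ord0 i) - k.+1%:R^-1, ratr (q ord0 i) + k.+1%:R^-1[]).
  exact: measurable_itv.
by apply/seteqP; split => r /=; rewrite in_itv /= ltr_distlC.
Qed.

(** An open set is the union of the boxes with rational centre and radius
    1/(k+1) that it contains, and there are countably many of them. *)
Lemma open_measurable_rV (U : set 'rV[R]_n) : open U -> measurable U.
Proof.
move=> oU.
pose F k := if (unpickle k : option ('rV[rat]_n * nat)) is Some qk then
  (if `[< box qk.1 qk.2 `<=` U >] then box qk.1 qk.2 else set0) else set0.
have -> : U = \bigcup_k F k.
  apply/seteqP; split=> [x Ux|x [k _]]; last first.
    by rewrite /F; case: (unpickle k) => // qk; case: asboolP => // + bx; exact.
  have [e e0 xe] : exists2 e : R, 0 < e & ball x e `<=` U.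
    have := open_nbhs_nbhs (conj oU Ux) => /nbhs_ballP[e /= e0 xe].
    by exists e.
  have [k ke] : exists k : nat, k.+1%:R^-1 < e / 2.
    have := near_infty_natSinv_lt (PosNum (divr_gt0 e0 (ltr0n R 2))) => -[k _ Hk].
    by exists k; exact: (Hk k (leqnn k)).
  have /choice[q Hq] (i : 'I_n) : exists q : rat, `|ratr q - x ord0 i| < k.+1%:R^-1.
    have [|q] := @rat_in_itvoo R (x ord0 i - k.+1%:R^-1) (x ord0 i + k.+1%:R^-1).
      by rewrite ltrD2l gtrN.
    by rewrite in_itv /= => xq; exists q; rewrite ltr_distl.
  have xbox : box (\row_i q i) k x by move=> i; rewrite mxE.
  exists (pickle (\row_i q i, k)) => //; rewrite /F pickleK /=.
  case: asboolP => // -[] y ybox; apply: xe; split => // i j.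
  rewrite (ord1 i) /ball /=.
  rewrite -(subrKA (ratr ((\row_i q i) ord0 j))) (le_lt_trans (ler_normD _ _))//.
  by rewrite [e]splitr ltrD// (lt_trans _ ke)// distrC; exact: xbox.
apply: bigcupT_measurable => k; rewrite /F; case: (unpickle k) => // qk.
by case: asboolP.
Qed.

Lemma closed_measurable_rV (K : set 'rV[R]_n) : closed K -> measurable K.
Proof. by move/closed_openC/open_measurable_rV/measurableC; rewrite setCK. Qed.

Lemma compact_measurable_rV (K : set 'rV[R]_n) : compact K -> measurable K.
Proof. by move/(compact_closed (@norm_hausdorff _ _)); exact: closed_measurable_rV. Qed.

Lemma continuous_measurable_fun_rV u : continuous u -> measurable_fun setT u.
Proof.
move=> /continuousP cu; apply: (measurability _ (RGenOpens.measurableE R)).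
move=> _ [_ [a [b ->] <-]]; rewrite setTI.
by apply: open_measurable_rV; apply: cu; exact: interval_open.
Qed.

End measurable_rV.

Section bounded_support_integrable.
Context d (T : measurableType d) (R : realType) (mu : {measure set T -> \bar R}).
Variables (f : T -> R) (A : set T) (B : R).
Hypotheses (mA : measurable A) (muA : (mu A < +oo)%E).
Hypotheses (B0 : 0 <= B) (mf : measurable_fun setT f) (fB : forall x, `|f x| <= B)
  (fA : forall x, f x != 0 -> A x).

Lemma bounded_support_integrable D : measurable D -> mu.-integrable D (EFin \o f).
Proof.
move=> mD; apply: (@integrableS _ _ _ _ setT) => //.
have -> : EFin \o f = (EFin \o f) \_ A.
  apply/funext => x; rewrite patchE; case: ifPn => //= xA.
  by have [->|/fA] := eqVneq (f x) 0; last by move/mem_set; rewrite (negbTE xA).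
apply/(integrable_mkcond _ mA)/measurable_bounded_integrable => //.
  exact: measurable_funTS.
exists B; split; first exact: num_real.
by move=> y By x /= _; rewrite (le_trans (fB x))// ltW.
Qed.

Lemma bounded_support_Rintegral D : measurable D ->
  `|\int[mu]_(x in D) f x| <= B * fine (mu A).
Proof.
move=> mD.
have -> : \int[mu]_(x in D) f x = \int[mu]_(x in D `&` A) f x.
  rewrite Rintegral_mkcondr; congr fine; apply: eq_integral => x _ /=.
  rewrite patchE; case: ifPn => //= xA; congr EFin.
  by have [->|/fA] := eqVneq (f x) 0; last by move/mem_set; rewrite (negbTE xA).
have mDA : measurable (D `&` A) by exact: measurableI.
have muDA : (mu (D `&` A) < +oo)%E.
  by apply: le_lt_trans muA; apply: le_measure; rewrite ?inE//; exact: subIsetr.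
apply: (le_trans (le_normr_Rintegral mDA (bounded_support_integrable mDA))).
apply: (@le_trans _ _ (\int[mu]_(x in D `&` A) B)).
  apply: le_Rintegral => //.
  - exact/integrable_norm/bounded_support_integrable.
  - apply: measurable_bounded_integrable => //; exists B.
    split; first exact: num_real.
    by move=> y By x _ /=; rewrite ger0_norm// ltW.
rewrite Rintegral_cst// ler_wpM2l//.
by apply: fine_le; rewrite ?ge0_fin_numE//; apply: le_measure; rewrite ?inE//;
  exact: subIsetr.
Qed.

End bounded_support_integrable.

Section lebesgue_rV_integral.
Variable R : realType.
Local Notation mu := (@lebesgue_measure R).

Lemma rV_norm_le n (x : 'rV[R]_n) (M : R) : 0 <= M ->
  (forall j, `|x ord0 j| <= M) -> `|x| <= M.
Proof.
move=> M0 H; rewrite [leLHS]/Num.Def.normr/= mx_normrE.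
by apply: bigmax_le => // -[i j] _ /=; rewrite (ord1 i).
Qed.

Lemma rV_cons_norm n (p : R * 'rV[R]_n) (M : R) : 0 <= M ->
  `|rV_cons p| <= M <-> `|p.1| <= M /\ `|p.2| <= M.
Proof.
move=> M0; split=> [pM|[p1 p2]].
  split; first by rewrite -(rV_cons0 p) (le_trans (coord_le_norm _ _)).
  apply: rV_norm_le => // j.
  by rewrite -(rV_consS p) (le_trans (coord_le_norm _ _)).
apply: rV_norm_le => // j; have [k ->|->] := unliftP ord0 j.
  by rewrite rV_consS (le_trans (coord_le_norm _ _)).
by rewrite rV_cons0.
Qed.

Lemma measurable_norm_ball n (M : R) : measurable [set x : 'rV[R]_n | `|x| <= M].
Proof. by apply: compact_measurable_rV; exact: closed_ball_compact. Qed.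

Lemma lebesgue_itv_lty (a b : R) : (mu [set` `[a, b]] < +oo)%E.
Proof. by rewrite lebesgue_measure_itv/=; case: ifP => _; rewrite ltry. Qed.

Lemma lebesgue_rV_ball n (M : R) :
  (lebesgue_rV n [set x : 'rV[R]_n | (`|x| <= M)%R] < +oo)%E.
Proof.
have [M0|M0] := ltP M 0.
  rewrite (_ : [set x | _] = set0) ?measure0//.
  by apply/seteqP; split => x //=; rewrite leNgt (lt_le_trans M0).
elim: n => [|n IH] /=.
  by rewrite /dirac indicE; case: (_ \in _); rewrite ltry.
rewrite /leb_step /pushforward.
have -> : @rV_cons R n @^-1` [set x | `|x| <= M] =
    [set` `[- M, M]] `*` [set x | `|x| <= M].
  apply/seteqP; split=> p /=; rewrite in_itv /= -ler_norml.
    by move/(rV_cons_norm p M0).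
  by move/(rV_cons_norm p M0).
rewrite product_measure1E//; [|exact: measurable_norm_ball].
rewrite lte_mul_pinfty//.
by rewrite ge0_fin_numE//; exact: lebesgue_itv_lty.
Qed.

Lemma continuous_bounded_supp_integrable n (u : 'rV[R]_n -> R) D :
  continuous u -> bounded_supp u -> measurable D ->
  (lebesgue_rV n).-integrable D (EFin \o u).
Proof.
move=> cu bu; have [B HB] := continuous_bounded_supp cu bu.
have [M HM] := bu.
apply: (@bounded_support_integrable _ _ _ _ u [set x | `|x| <= M] B) => //.
- exact: measurable_norm_ball.
- exact: lebesgue_rV_ball.
- exact: continuous_measurable_fun_rV.
Qed.

Lemma continuous_compact_integrable_rV n (u : 'rV[R]_n -> R) K :
  continuous u -> compact K -> (lebesgue_rV n).-integrable K (EFin \o u).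
Proof.
move=> cu cK; apply: measurable_bounded_integrable.
- exact: compact_measurable_rV.
- have [M [_ HM]] := compact_bounded cK.
  apply: le_lt_trans (lebesgue_rV_ball n (`|M| + 1)).
  apply: le_measure; rewrite ?inE; [exact: compact_measurable_rV|
    exact: measurable_norm_ball|].
  by move=> x Kx /=; apply: HM => //; rewrite ltr_pwDr// ler_norm.
- by apply: measurable_funTS; exact: continuous_measurable_fun_rV.
- have := continuous_compact (continuous_subspaceT cu) cK.
  move=> /compact_bounded[B [Br HB]]; exists B; split=> // y By x /= Kx.
  by apply: (HB y By); exists x.
Qed.

Lemma continuous_rV_consl n (y : 'rV[R]_n) : continuous (fun t : R => rV_cons (t, y)).
Proof.
have -> : (fun t : R => rV_cons (t, y)) =
    fun t => t *: delta_mx 0 ord0 + rV_cons (0, y).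
  apply/funext => t; apply/rowP => j.
  rewrite [RHS]mxE [X in _ = X + _]mxE [delta_mx _ _ _ _]mxE eqxx /=.
  have [k ->|->] := unliftP ord0 j; rewrite ?rV_consS ?rV_cons0 /=.
    by rewrite mulr0 add0r.
  by rewrite mulr1 addr0.
by move=> t; apply: cvgD; [apply: cvgZl; exact: cvg_id|exact: cvg_cst].
Qed.

(** Fubini for the recursive construction of the measure: the first coordinate
    is split off, and the integrand lives on a box of finite measure. *)
Lemma Rintegral_rV_cons n (u : 'rV[R]_n.+1 -> R) :
  continuous u -> bounded_supp u ->
  \int[lebesgue_rV n.+1]_x u x =
  \int[lebesgue_rV n]_y \int[mu]_t u (rV_cons (t, y)).
Proof.
move=> cu bu; have iu := continuous_bounded_supp_integrable cu bu measurableT.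
have [B HB] := continuous_bounded_supp cu bu; have [M HM] := bu.
have muu := continuous_measurable_fun_rV cu.
have mc : measurable_fun setT (u \o @rV_cons R n).
  exact: (measurableT_comp muu (@measurable_rV_cons R n)).
have B0 : 0 <= B by apply: le_trans (HB 0).
pose A : set (R * 'rV[R]_n) := [set` `[- `|M|, `|M|]] `*` [set x | `|x| <= `|M|].
have mA : measurable A by apply: measurableX => //; exact: measurable_norm_ball.
have muA : ((mu \x lebesgue_rV n)%E A < +oo)%E.
  rewrite product_measure1E//; [|exact: measurable_norm_ball].
  rewrite lte_mul_pinfty//; last exact: lebesgue_rV_ball.
  by rewrite ge0_fin_numE//; exact: lebesgue_itv_lty.
have ic : (mu \x lebesgue_rV n)%E.-integrable setT (EFin \o (u \o @rV_cons R n)).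
  apply: (@bounded_support_integrable _ _ _ (mu \x lebesgue_rV n)%E
    (u \o @rV_cons R n) A B) => //.
    by move=> p; exact: HB.
  move=> p /HM pM; have : `|rV_cons p| <= `|M| by rewrite (le_trans pM)// ler_norm.
  by move=> /(rV_cons_norm p (normr_ge0 M))[p1 p2]; split=> //=; rewrite in_itv/= -ler_norml.
rewrite /Rintegral /=.
have -> : (\int[leb_step (lebesgue_rV n)]_x (u x)%:E =
    \int[(mu \x lebesgue_rV n)%E]_p (u (rV_cons p))%:E)%E.
  rewrite /leb_step integral_pushforward//=.
  - exact: measurable_rV_cons.
  - exact/measurable_EFinP.
rewrite -(integral21_prod_meas1 ic) /fubini_G; congr fine.
apply: eq_integral => y _ /=; rewrite fineK//.
apply: integrable_fin_num => //.
apply: (@bounded_support_integrable _ _ _ mu (fun t => u (rV_cons (t, y)))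
  [set` `[- `|M|, `|M|]] B) => //.
- exact: lebesgue_itv_lty.
- apply: continuous_measurable_fun => t.
  exact: (continuous_comp (@continuous_rV_consl n y t) (cu _)).
- move=> t /HM pM; have : `|rV_cons (t, y)| <= `|M| by rewrite (le_trans pM)// ler_norm.
  by move=> /(rV_cons_norm (t, y) (normr_ge0 M))[p1 p2] /=; rewrite in_itv/= -ler_norml.
Qed.

End lebesgue_rV_integral.

(** * Composition with coordinate maps *)
Section affine_composition.
Variable R : realType.

Lemma lipschitz1_continuous m n (L : 'rV[R]_m -> 'rV[R]_n) :
  (forall x y, `|L x - L y| <= `|x - y|) -> continuous L.
Proof.
move=> HL x; have F : Filter (nbhs x) by exact: nbhs_filter.
apply/(@cvgrPdist_le _ _ _ (nbhs x) F) => e e0.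
have /cvgrPdist_le/(_ e e0) : (fun y : 'rV[R]_m => y) y @[y --> x] --> x.
  exact: cvg_id.
by apply: filterS => y; apply: le_trans; exact: HL.
Qed.

Lemma derive_comp_affine (U V : normedModType R) (L : U -> V) (u : V -> R) x e v :
  (forall h : R, L (x + h *: e) = L x + h *: v) ->
  (derivable (u \o L) x e <-> derivable u (L x) v) /\
  'D_e (u \o L) x = 'D_v u (L x).
Proof.
move=> HL; rewrite /derivable /derive.
suff -> : (fun h : R => h^-1 *: (((u \o L) \o shift x) (h *: e) - (u \o L) x)) =
    (fun h => h^-1 *: ((u \o shift (L x)) (h *: v) - u (L x))) by [].
by apply/funext => h /=; rewrite ![h *: _ + _]addrC HL.
Qed.

(** The maps L in view are injections and projections of coordinates: each
    basis vector is sent to a basis vector or to 0.  Such maps permute or kill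
    first-order derivatives, hence preserve smoothness. *)
Lemma smooth_comp_affine m n (L : 'rV[R]_m -> 'rV[R]_n) (u : 'rV[R]_n -> R) :
  (forall x y, `|L x - L y| <= `|x - y|) ->
  (forall j, (exists k, forall x (h : R),
                L (x + h *: delta_mx 0 j) = L x + h *: delta_mx 0 k) \/
             (forall x (h : R), L (x + h *: delta_mx 0 j) = L x)) ->
  smooth u -> smooth (u \o L).
Proof.
move=> L1 HL su.
apply: (@smooth_coind _ _ [set w | exists v, smooth v /\ w = v \o L]); last first.
  by exists u.
move=> {u su} _ [u [su ->]]; split=> [x|j].
  apply: continuous_comp; first exact: lipschitz1_continuous.
  exact: smooth_continuous.
have [[k Lk]|L0] := HL j.
  have D x := derive_comp_affine u (Lk x).
  split=> [x|]; first by apply/(D x).1; exact: smooth_derivable.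
  exists ('D_(delta_mx 0 k) u); split; first exact: smooth_derive.
  by apply/funext => x; rewrite (D x).2.
have L0' x (h : R) : L (x + h *: delta_mx 0 j) = L x + h *: 0.
  by rewrite scaler0 addr0.
have D x := derive_comp_affine u (L0' x).
split=> [x|]; first by apply/(D x).1; exact: derivable0.
exists (fun=> 0); split; first exact: smooth_cst.
by apply/funext => x; rewrite (D x).2 derive0.
Qed.

End affine_composition.

(** * Integrals along lines in the first direction *)
Section slices.
Variables (R : realType) (n : nat).
Local Notation mu := (@lebesgue_measure R).
Local Notation e0 := (delta_mx 0 ord0 : 'rV[R]_n.+1).
Local Notation e_ j := (delta_mx 0 j : 'rV[R]_n.+1).
Implicit Types (u : 'rV[R]_n.+1 -> R) (x : 'rV[R]_n.+1) (D : set R).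

(** The variable of integration is measured from x, so that derivatives in all
    directions, including the first one, commute with the integral.  With D
    the whole line this is the integral over the line through x, and with D
    the negative half-line it is the primitive of u in the first variable. *)
Definition slice_int D u x : R := \int[mu]_(s in D) u (x + s *: e0).

Lemma delta_norm m (j : 'I_m) : `|delta_mx 0 j : 'rV[R]_m| <= 1.
Proof.
apply: rV_norm_le => // k; rewrite mxE eqxx /=.
by case: eqP => _; rewrite ?normr1// normr0.
Qed.

Lemma slice_norm x (s : R) : `|s| <= `|x + s *: e0| + `|x|.
Proof.
have sE : s = (x + s *: e0) ord0 ord0 - x ord0 ord0.
  by rewrite !mxE !eqxx mulr1 addrAC subrr add0r.
by rewrite [in leLHS]sE (le_trans (ler_normB _ _))// lerD// coord_le_norm.
Qed.

Lemma continuous_slice u x : continuous u -> continuous (fun s : R => u (x + s *: e0)).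
Proof.
move=> cu s.
have cs : {for s, continuous (fun s : R => x + s *: e0)}.
  by apply: cvgD; [exact: cvg_cst|apply: cvgZl; exact: cvg_id].
exact: (continuous_comp cs (cu _)).
Qed.

Section bounded.
Variables (u : 'rV[R]_n.+1 -> R) (M : R).
Hypotheses (cu : continuous u) (uM : forall x, u x != 0 -> `|x| <= M).

Let slice_supp x s : u (x + s *: e0) != 0 -> [set` `[- (M + `|x|), M + `|x|]] s.
Proof.
move=> /uM us /=; rewrite in_itv /= -ler_norml.
by apply: (le_trans (slice_norm x s)); rewrite lerD2r.
Qed.

Lemma slice_integrable D x : measurable D ->
  mu.-integrable D (EFin \o (fun s => u (x + s *: e0))).
Proof.
have bu : bounded_supp u by exists M.
have [B HB] := continuous_bounded_supp cu bu.
have K0 : 0 <= B by exact: (le_trans (normr_ge0 _) (HB 0)).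
apply: (@bounded_support_integrable _ _ _ mu _ [set` `[- (M + `|x|), M + `|x|]] B) => //.
- exact: lebesgue_itv_lty.
- by apply: continuous_measurable_fun; exact: continuous_slice.
- exact: slice_supp.
Qed.

Lemma slice_bound D x B : measurable D -> (forall x, `|u x| <= B) ->
  `|slice_int D u x| <= B * fine (mu [set` `[- (M + `|x|), M + `|x|]]).
Proof.
move=> mD HB; apply: bounded_support_Rintegral => //.
- exact: lebesgue_itv_lty.
- exact: (le_trans (normr_ge0 _) (HB 0)).
- by apply: continuous_measurable_fun; exact: continuous_slice.
- exact: slice_supp.
Qed.

End bounded.

Lemma slice_lin3 D u (v w : 'rV[R]_n.+1 -> R) x (h : R) : measurable D ->
  continuous u -> bounded_supp u -> continuous v -> bounded_supp v ->
  continuous w -> bounded_supp w ->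
  slice_int D (fun z => u z - v z - h * w z) x =
  slice_int D u x - slice_int D v x - h * slice_int D w x.
Proof.
move=> mD cu [M uM] cv [M' vM] cw [M'' wM]; rewrite /slice_int.
have iu := slice_integrable cu uM x mD.
have iv := slice_integrable cv vM x mD.
have iw := slice_integrable cw wM x mD.
rewrite RintegralB//.
- by rewrite RintegralB// RintegralZl.
- by apply: (eq_integrable _ _ _ _ (integrableB _ iu iv)) => // s _ /=;
    rewrite EFinB.
- by apply: (eq_integrable _ _ _ _ (integrableZl _ h iw)) => // s _ /=;
    rewrite EFinM.
Qed.

Lemma slice_shift D u x a :
  slice_int D u (x + a) = slice_int D (fun z => u (z + a)) x.
Proof. by congr fine; apply: eq_integral => s _; rewrite addrAC. Qed.

Lemma bounded_supp_shift u (M : R) a : (forall x, u x != 0 -> `|x| <= M) ->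
  `|a| <= 1 -> forall x, u (x + a) != 0 -> `|x| <= M + 1.
Proof.
move=> uM a1 x /uM xa; rewrite -(addrK a x) (le_trans (ler_normB _ _))//.
exact: lerD.
Qed.

(** Derivation under the integral: the Taylor remainder is bounded by a
    multiple of h^2 and vanishes outside a bounded part of the line. *)
Lemma slice_is_derive D u x j : measurable D -> real_test u ->
  is_derive x (e_ j) (slice_int D u) (slice_int D ('D_(e_ j) u) x).
Proof.
move=> mD ru; have [su [M uM]] := ru.
have [B HB] := real_test_partials_bounded 2 ru.
have [sdu [M' duM]] := real_test_derive j ru.
pose K := Num.max (M + 1) M'.
apply: (@is_derive_quadratic _ _ _ _ _ _
  (B * fine (mu [set` `[- (K + `|x|), K + `|x|]]))) => h h1.
pose r z := u (z + h *: e_ j) - u z - h * 'D_(e_ j) u z.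
have ha1 : `|h *: e_ j| <= 1.
  by rewrite normrZ (le_trans _ h1)// ler_piMr// delta_norm.
have ssh := smooth_shift (h *: e_ j) su.
have bsh : bounded_supp (fun z => u (z + h *: e_ j)).
  by exists (M + 1); exact: bounded_supp_shift.
have -> : slice_int D u (x + h *: e_ j) - slice_int D u x -
    h * slice_int D ('D_(e_ j) u) x = slice_int D r x.
  rewrite slice_shift; apply/esym.
  exact: (slice_lin3 x h mD (smooth_continuous ssh) bsh (smooth_continuous su)
    ru.2 (smooth_continuous sdu) (real_test_derive j ru).2).
have cr : continuous r.
  exact: (smooth_continuous (smoothB (smoothB ssh su) (smoothM (smooth_cst h) sdu))).
rewrite mulrAC; apply: slice_bound => //.
  move=> z; apply: contraNT; rewrite -ltNge gt_max => /andP[zM zM'].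
  have dz : 'D_(e_ j) u z = 0.
    by apply/eqP; apply: contraTT zM' => /duM; rewrite -leNgt.
  rewrite /r dz (_ : u (z + h *: e_ j) = 0).
    rewrite (_ : u z = 0) ?mulr0 ?subrr ?eqxx//.
    apply/eqP; apply: contraTT zM => /uM zM; rewrite -leNgt (le_trans zM)//.
    by rewrite lerDl.
  by apply/eqP; apply: contraTT zM => /(bounded_supp_shift uM ha1); rewrite -leNgt.
move=> z.
exact: (derive_taylor z h (fun y => smooth_derivable j y su)
  (fun y => smooth_derivable j y sdu) (HB [:: j; j] isT)).
Qed.

Lemma slice_continuous D u : measurable D -> real_test u -> continuous (slice_int D u).
Proof.
move=> mD ru x; have [su [M uM]] := ru.
have [B HB] := real_test_lipschitz ru.
pose K := M + 1.
apply: (@locally_lipschitz_continuous _ _ _ _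
  (B * fine (mu [set` `[- (K + `|x|), K + `|x|]]))) => a a1.
(* a third term with coefficient 0, so that slice_lin3 applies *)
pose r z := u (z + a) - u z - 0 * u z.
have ssh := smooth_shift a su.
have bsh : bounded_supp (fun z => u (z + a)).
  by exists (M + 1); exact: bounded_supp_shift.
have -> : slice_int D u (x + a) - slice_int D u x = slice_int D r x.
  rewrite slice_shift.
  have := slice_lin3 x 0 mD (smooth_continuous ssh) bsh (smooth_continuous su)
    ru.2 (smooth_continuous su) ru.2.
  by rewrite mul0r subr0 => <-.
have cr : continuous r.
  exact: (smooth_continuous (smoothB (smoothB ssh su) (smoothM (smooth_cst 0) su))).
rewrite mulrAC; apply: slice_bound => //.
  move=> z; apply: contraNT; rewrite -ltNge => zM.
  rewrite /r (_ : u (z + a) = 0).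
    rewrite (_ : u z = 0) ?mulr0 ?subrr ?eqxx//.
    apply/eqP; apply: contraTT zM => /uM zM; rewrite -leNgt (le_trans zM)//.
    by rewrite lerDl.
  by apply/eqP; apply: contraTT zM => /(bounded_supp_shift uM a1); rewrite -leNgt.
by move=> z; rewrite /r mul0r subr0; exact: HB.
Qed.

Lemma slice_smooth D u : measurable D -> real_test u -> smooth (slice_int D u).
Proof.
move=> mD ru.
apply: (@smooth_coind _ _ [set w | exists v, real_test v /\ w = slice_int D v]); last first.
  by exists u.
move=> {u ru} _ [u [ru ->]]; split; first exact: slice_continuous.
move=> j; split=> [x|].
  by have [] := slice_is_derive x j mD ru.
exists ('D_(e_ j) u); split; first exact: real_test_derive.
by apply/funext => x; have [] := slice_is_derive x j mD ru.
Qed.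

Lemma slice_itv (a b : R) u x : a < b -> smooth u ->
  slice_int [set` `[a, b]] ('D_e0 u) x = u (x + b *: e0) - u (x + a *: e0).
Proof.
move=> ab su; rewrite /slice_int /Rintegral.
have dl (t : R) : is_derive t (1 : R) (fun t : R => u (x + t *: e0))
    ('D_e0 u (x + t *: e0)).
  by apply: is_derive_line; exact: smooth_derivable.
have cl := continuous_slice (x := x) (smooth_continuous su).
have cdl := continuous_slice (x := x) (smooth_continuous (smooth_derive ord0 su)).
rewrite (@continuous_FTC2 _ (fun t => 'D_e0 u (x + t *: e0))
  (fun t => u (x + t *: e0)))//.
- exact: continuous_subspaceT.
- split.
  + by move=> t _; have [] := dl t.
  + by apply: cvg_at_right_filter; exact: cl.
  + by apply: cvg_at_left_filter; exact: cl.
- by move=> t _; rewrite derive1E; have [] := dl t.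
Qed.

Lemma slice_restrict D u x (K : R) :
  (forall s, D s -> K < `|s| -> u (x + s *: e0) = 0) ->
  slice_int D u x = slice_int (D `&` [set` `[- K, K]]) u x.
Proof.
move=> H; rewrite /slice_int Rintegral_mkcondr; congr fine.
apply: eq_integral => s /set_mem Ds /=; rewrite patchE; case: ifPn => //= sK.
rewrite H//; rewrite ltNge ler_norml; apply: contraNN sK => sK; apply/mem_set.
by rewrite /= in_itv.
Qed.

Lemma slice_far u x : real_test u ->
  exists2 K : R, 0 < K & forall s, K <= `|s| -> u (x + s *: e0) = 0.
Proof.
move=> [_ [M uM]]; exists (`|M| + `|x| + 1); first by rewrite ltr_pwDr// addr_ge0.
move=> s Ks; apply/eqP; apply: contraTT Ks => /uM us; rewrite -ltNge.
rewrite (le_lt_trans (slice_norm x s))//.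
by rewrite (le_lt_trans (lerD (le_trans us (ler_norm M)) (lexx _)))// ltrDl.
Qed.

Lemma sliceT_derive u x : real_test u -> slice_int setT ('D_e0 u) x = 0.
Proof.
move=> ru; have [K K0 uK] := slice_far x ru.
have [K' _ duK] := slice_far x (real_test_derive ord0 ru).
pose L := Num.max K K'; have L0 : 0 < L by rewrite lt_max K0.
rewrite (slice_restrict (K := L)); last first.
  by move=> s _ /ltW Ls; apply: duK; rewrite (le_trans _ Ls)// le_max lexx orbT.
rewrite setTI slice_itv//; [|by rewrite gtrN|exact: ru.1].
by rewrite !uK ?subrr// ?normrN (gtr0_norm L0) le_max lexx.
Qed.

Lemma sliceNy_derive u x : real_test u -> slice_int [set` `]-oo, 0]] ('D_e0 u) x = u x.
Proof.
move=> ru; have [K K0 uK] := slice_far x ru.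
have [K' _ duK] := slice_far x (real_test_derive ord0 ru).
pose L := Num.max K K'; have L0 : 0 < L by rewrite lt_max K0.
rewrite (slice_restrict (K := L)); last first.
  by move=> s _ /ltW Ls; apply: duK; rewrite (le_trans _ Ls)// le_max lexx orbT.
have -> : [set` `]-oo, 0%R]] `&` [set` `[- L, L]] = [set` `[- L, 0]].
  apply/seteqP; split=> s /=; rewrite !in_itv /=; first by move=> [-> /andP[->]].
  by move=> /andP[-> s0]; rewrite s0 (le_trans s0)// ltW.
rewrite slice_itv//; [|by rewrite oppr_lt0|exact: ru.1].
rewrite scale0r addr0 uK ?subr0// normrN (gtr0_norm L0) le_max lexx//.
Qed.

Lemma derive_sliceNy u : real_test u -> 'D_e0 (slice_int [set` `]-oo, 0]] u) = u.
Proof.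
move=> ru; apply/funext => x.
have [_ ->] := slice_is_derive x ord0 (measurable_itv `]-oo, 0]) ru.
exact: sliceNy_derive.
Qed.

Lemma sliceT_invariant u x (h : R) : real_test u ->
  slice_int setT u (x + h *: e0) = slice_int setT u x.
Proof.
move=> ru; have D y := slice_is_derive y ord0 measurableT ru.
have [|t _] := @derive_mvt _ _ (slice_int setT u) e0 _ x h.
  by move=> y; have [] := D y.
have [_ ->] := D (x + t *: e0); rewrite sliceT_derive// mulr0.
by move/eqP; rewrite subr_eq0 => /eqP.
Qed.

(** Past the support of u in the first direction the primitive equals the
    integral over the whole line. *)
Lemma sliceNy_bounded_supp u : real_test u -> (forall x, slice_int setT u x = 0) ->
  bounded_supp (slice_int [set` `]-oo, 0]] u).
Proof.
move=> ru u0; have [su [M uM]] := ru.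
exists `|M| => x; apply: contraNT => xM.
have z (s : R) : (exists j, M < `|(x + s *: e0) ord0 j|) -> u (x + s *: e0) = 0.
  move=> [j Hj]; apply/eqP; apply: contraTT Hj => /uM sM.
  by rewrite -leNgt (le_trans (coord_le_norm _ _)).
have [j xj] : exists j, `|M| < `|x ord0 j|.
  apply/not_existsP => H; move/negP: xM; apply; apply: rV_norm_le => // j.
  by rewrite leNgt; apply/negP.
have MM : M <= `|M| by exact: ler_norm.
have zero D : (forall s, D s -> u (x + s *: e0) = 0) -> slice_int D u x = 0.
  move=> H; rewrite /slice_int /Rintegral integral0_eq//= => s Ds.
  by rewrite H.
have [k jk|j0] := unliftP ord0 j.
  apply/eqP/zero => s _; apply: z; exists j; rewrite jk !mxE /= mulr0 addr0 -jk.
  exact: le_lt_trans xj.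
rewrite j0 in xj.
have coord0 s : (x + s *: e0) ord0 ord0 = x ord0 ord0 + s.
  by rewrite !mxE !eqxx mulr1.
have [x0|x0] := leP (x ord0 ord0) 0.
  apply/eqP/zero => s /=; rewrite in_itv /= => s0; apply: z; exists ord0.
  rewrite coord0 (le_lt_trans MM)// (lt_le_trans xj)//.
  have xs0 : x ord0 ord0 + s <= 0 by lra.
  by rewrite (ler0_norm x0) (ler0_norm xs0) lerN2 gerDl.
apply/eqP; rewrite -[RHS](u0 x) /slice_int [RHS]Rintegral_mkcond Rintegral_mkcond.
congr fine; apply: eq_integral => s _; rewrite /= !patchE in_setT; case: ifPn => // s0.
congr EFin; apply/esym/z; exists ord0.
have {}s0 : 0 < s.
  rewrite ltNge; apply/negP => sle; move/negP: s0; apply; apply/mem_set.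
  by rewrite /= in_itv.
rewrite coord0 (le_lt_trans MM)// (lt_trans xj)//.
by rewrite !gtr0_norm ?ltrDl ?addr_gt0.
Qed.

End slices.

(** * Functionals that vanish on all partial derivatives *)
Section coordinates.
Variables (R : realType) (n : nat).
Local Notation e0 := (delta_mx 0 ord0 : 'rV[R]_n.+1).

Definition tail (x : 'rV[R]_n.+1) : 'rV[R]_n := (rV_uncons x).2.

Lemma rV_cons_tail (x : 'rV[R]_n.+1) : rV_cons (x ord0 ord0, tail x) = x.
Proof.
apply/rowP => j; have [k ->|->] := unliftP ord0 j; last by rewrite rV_cons0.
by rewrite rV_consS mxE.
Qed.

Lemma tail_cons (t : R) (y : 'rV[R]_n) : tail (rV_cons (t, y)) = y.
Proof. by rewrite /tail rV_consK. Qed.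

Lemma tailD (x y : 'rV[R]_n.+1) : tail (x + y) = tail x + tail y.
Proof. by apply/rowP => j; rewrite !mxE. Qed.

Lemma tailZ (h : R) (x : 'rV[R]_n.+1) : tail (h *: x) = h *: tail x.
Proof. by apply/rowP => j; rewrite !mxE. Qed.

Lemma tail_delta0 : tail e0 = 0.
Proof. by apply/rowP => j; rewrite !mxE. Qed.

Lemma tail_delta (k : 'I_n) : tail (delta_mx 0 (lift ord0 k)) = delta_mx 0 k.
Proof. by apply/rowP => j; rewrite !mxE (inj_eq lift_inj). Qed.

Lemma rV_consD (t s : R) (x y : 'rV[R]_n) :
  rV_cons (t + s, x + y) = rV_cons (t, x) + rV_cons (s, y).
Proof.
apply/rowP => j; rewrite [RHS]mxE.
by have [k ->|->] := unliftP ord0 j; rewrite ?rV_cons0 ?rV_consS//= mxE.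
Qed.

Lemma rV_consZ (h t : R) (x : 'rV[R]_n) :
  rV_cons (h * t, h *: x) = h *: rV_cons (t, x).
Proof.
apply/rowP => j; rewrite [RHS]mxE.
by have [k ->|->] := unliftP ord0 j; rewrite ?rV_cons0 ?rV_consS//= mxE.
Qed.

Lemma rV_cons_e0 : rV_cons (1, 0) = e0.
Proof. by rewrite -(rV_cons_tail e0) tail_delta0 mxE !eqxx. Qed.

Lemma rV_cons_eS (k : 'I_n) :
  rV_cons (0, delta_mx 0 k) = delta_mx 0 (lift ord0 k) :> 'rV[R]_n.+1.
Proof. by rewrite -(rV_cons_tail (delta_mx 0 (lift ord0 k))) tail_delta mxE. Qed.

Lemma rV_cons_line (t s : R) (y : 'rV[R]_n) :
  rV_cons (t, y) + s *: e0 = rV_cons (t + s, y).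
Proof. by rewrite -rV_cons_e0 -rV_consZ -rV_consD mulr1 scaler0 addr0. Qed.

Lemma smooth_section (u : 'rV[R]_n.+1 -> R) : smooth u ->
  smooth (fun y : 'rV[R]_n => u (rV_cons (0, y))).
Proof.
apply: (@smooth_comp_affine _ _ _ (fun y => rV_cons (0, y))) => [x y|j].
  have -> : rV_cons (0, x) - rV_cons (0, y) = rV_cons (0, x - y).
    by rewrite -scaleN1r -rV_consZ -rV_consD mulr0 addr0 scaleN1r.
  by apply/(rV_cons_norm _ (normr_ge0 _)); rewrite /= normr0.
left; exists (lift ord0 j) => x h.
by rewrite -rV_cons_eS -rV_consZ -rV_consD mulr0 addr0.
Qed.

Lemma smooth_tail (u : 'rV[R]_n -> R) : smooth u -> smooth (u \o tail).
Proof.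
apply: smooth_comp_affine => [x y|j].
  rewrite -scaleN1r -tailZ -tailD scaleN1r; apply: rV_norm_le => // k.
  by rewrite mxE (le_trans (coord_le_norm _ _)).
have [k ->|->] := unliftP ord0 j.
  by left; exists k => x h; rewrite tailD tailZ tail_delta.
by right=> x h; rewrite tailD tailZ tail_delta0 scaler0 addr0.
Qed.

Lemma derive_tailS (u : 'rV[R]_n -> R) k x :
  'D_(delta_mx 0 (lift ord0 k)) (u \o tail) x = 'D_(delta_mx 0 k) u (tail x).
Proof.
apply: (derive_comp_affine u (L := tail) (v := delta_mx 0 k) _).2 => h.
by rewrite tailD tailZ tail_delta.
Qed.

Definition line_map (y : 'rV[R]_n) (x : 'rV[R]_n.+1) := rV_cons (x ord0 ord0, y).

Lemma line_mapD y x (h : R) j : line_map y (x + h *: delta_mx 0 j) =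
  line_map y x + h *: (if j == ord0 then e0 else 0).
Proof.
rewrite /line_map !mxE eqxx /= eq_sym; case: eqP => _ /=.
  by rewrite mulr1 rV_cons_line.
by rewrite mulr0 scaler0 !addr0.
Qed.

Lemma smooth_line (u : 'rV[R]_n.+1 -> R) y : smooth u -> smooth (u \o line_map y).
Proof.
apply: smooth_comp_affine => [x z|j].
  have -> : line_map y x - line_map y z = rV_cons ((x - z) ord0 ord0, 0).
    by rewrite /line_map -scaleN1r -rV_consZ -rV_consD scaleN1r subrr !mxE mulN1r.
  by apply/(rV_cons_norm _ (normr_ge0 _)); rewrite /= normr0 coord_le_norm.
have [j0|j0] := boolP (j == ord0).
  by left; exists ord0 => x h; rewrite line_mapD j0.
by right=> x h; rewrite line_mapD (negbTE j0) scaler0 addr0.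
Qed.

Lemma derive_lineS (u : 'rV[R]_n.+1 -> R) y k x :
  'D_(delta_mx 0 (lift ord0 k)) (u \o line_map y) x = 0.
Proof.
rewrite (derive_comp_affine u (L := line_map y) (v := 0) _).2 ?derive0// => h.
by rewrite line_mapD.
Qed.

End coordinates.

Section primitive.
Variables (R : realType) (n : nat).
Local Open Scope complex_scope.
Local Notation mu := (@lebesgue_measure R).
Local Notation e0 := (delta_mx 0 ord0 : 'rV[R]_n.+1).
Implicit Types (phi : testfun R n.+1) (psi : testfun R n).

Definition marginal phi (y : 'rV[R]_n) : R[i] :=
  slice_int setT (fun x => Re (phi x)) (rV_cons (0, y)) +i*
  slice_int setT (fun x => Im (phi x)) (rV_cons (0, y)).

Lemma real_test_marginal (u : 'rV[R]_n.+1 -> R) : real_test u ->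
  real_test (fun y : 'rV[R]_n => slice_int setT u (rV_cons (0, y))).
Proof.
move=> ru; split.
  by apply: smooth_section; exact: slice_smooth.
have [_ [M uM]] := ru.
exists `|M| => y; apply: contraNT; rewrite -ltNge => My.
apply/eqP; rewrite /slice_int /Rintegral integral0_eq//= => s _; congr EFin.
rewrite rV_cons_line; apply/eqP; apply: contraTT My => /uM us; rewrite -leNgt.
have : `|rV_cons (0 + s, y)| <= `|M| by rewrite (le_trans us)// ler_norm.
by move/(rV_cons_norm _ (normr_ge0 M)) => [].
Qed.

Lemma test_function_marginal phi : marginal phi \in @test_function R n.
Proof.
by apply/test_function_real_test; have [rp ip] := testfun_real_test phi;
  split; exact: real_test_marginal.
Qed.

Definition testfun_marginal phi := TestFun (test_function_marginal phi).

Lemma integral_marginal phi : integral_C (testfun_marginal phi) = integral_C phi.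
Proof.
have H (u : 'rV[R]_n.+1 -> R) : real_test u -> \int[lebesgue_rV n]_y
    slice_int setT u (rV_cons (0, y)) = \int[lebesgue_rV n.+1]_x u x.
  move=> [su bu]; rewrite (Rintegral_rV_cons (smooth_continuous su) bu).
  congr fine; apply: eq_integral => y _; congr EFin.
  by congr fine; apply: eq_integral => s _ /=; rewrite rV_cons_line add0r.
have [rp ip] := testfun_real_test phi.
by rewrite /integral_C /= !H.
Qed.

(** The primitive in the first variable is a test function because the total
    integral over each line vanishes. *)
Lemma marginal_eq0_derive phi : (forall y, marginal phi y = 0) ->
  exists chi : testfun R n.+1, phi = testfun_derive ord0 chi.
Proof.
move=> phi0; have [rp ip] := testfun_real_test phi.
have slice0 (u : 'rV[R]_n.+1 -> R) : real_test u ->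
    (forall y, slice_int setT u (rV_cons (0, y)) = 0) ->
    forall x, slice_int setT u x = 0.
  move=> ru u0 x; rewrite -(rV_cons_tail x) -[x ord0 ord0]add0r -rV_cons_line.
  by rewrite sliceT_invariant.
have rp0 := slice0 _ rp (fun y => congr1 (@Re R) (phi0 y)).
have ip0 := slice0 _ ip (fun y => congr1 (@Im R) (phi0 y)).
pose I u := slice_int [set` `]-oo, (0 : R)]] (u : 'rV[R]_n.+1 -> R).
have rI (u : 'rV[R]_n.+1 -> R) : real_test u ->
    (forall x, slice_int setT u x = 0) -> real_test (I u).
  by move=> ru u0; split; [exact: slice_smooth|exact: sliceNy_bounded_supp].
have tI : (fun x => I (fun x => Re (phi x)) x +i* I (fun x => Im (phi x)) x)
    \in @test_function R n.+1.
  by apply/test_function_real_test; split; exact: rI.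
exists (TestFun tI); apply: testfun_ext => x.
apply: eq_ReIm; apply: esym.
  exact: (congr1 (@^~ x) (derive_sliceNy rp)).
exact: (congr1 (@^~ x) (derive_sliceNy ip)).
Qed.

Lemma marginalB phi1 phi2 y :
  marginal (phi1 - phi2) y = marginal phi1 y - marginal phi2 y.
Proof.
have H (u v : 'rV[R]_n.+1 -> R) x : real_test u -> real_test v ->
    slice_int setT (fun z => u z - v z) x = slice_int setT u x - slice_int setT v x.
  move=> [su bu] [sv bv].
  have := @slice_lin3 R n setT u v v x 0 measurableT (smooth_continuous su) bu
    (smooth_continuous sv) bv (smooth_continuous sv) bv.
  rewrite mul0r subr0 => <-; congr slice_int.
  by apply/funext => z; rewrite mul0r subr0.
have [r1 i1] := testfun_real_test phi1; have [r2 i2] := testfun_real_test phi2.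
apply: eq_ReIm.
  rewrite creD creN /= -H//; congr slice_int.
  by apply/funext => x; rewrite -creN -creD.
rewrite cimD cimN /= -H//; congr slice_int.
by apply/funext => x; rewrite -cimN -cimD.
Qed.

Section tensor.
Variables (phi0 : testfun R n.+1) (y0 : 'rV[R]_n).
Hypothesis c0 : marginal phi0 y0 != 0.

(** A function of the first coordinate alone, of integral 1 over each line; it
    serves as cut-off function. *)
Let chi (x : 'rV[R]_n.+1) : R[i] := phi0 (line_map y0 x) / marginal phi0 y0.

Let csmooth_chi : csmooth chi.
Proof.
apply: csmoothM; last exact: csmooth_cst.
by have [[rp _] [ip _]] := testfun_real_test phi0;
  split; [exact: (smooth_line y0 rp)|exact: (smooth_line y0 ip)].
Qed.

Let csmooth_tail psi : csmooth (psi \o @tail R n).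
Proof.
by have [[rp _] [ip _]] := testfun_real_test psi;
  split; [exact: (smooth_tail rp)|exact: (smooth_tail ip)].
Qed.

Let tensor_test psi : (fun x => chi x * psi (tail x)) \in @test_function R n.+1.
Proof.
apply/test_functionP; split; first exact: (csmoothM csmooth_chi (csmooth_tail psi)).
have [K HK] := testfun_bounded phi0; have [K' HK'] := testfun_bounded psi.
apply: (supp_compact_sub (@closed_ball_compact R n.+1 (Num.max `|K| `|K'|))) => x.
rewrite !mulf_eq0 !negb_or => /andP[/andP[/HK xK _] /HK' xK'] /=.
have M0 : 0 <= Num.max `|K| `|K'| by rewrite le_max normr_ge0.
rewrite -(rV_cons_tail x); apply/(rV_cons_norm _ M0) => /=; split; last first.
  by rewrite (le_trans xK')// le_max ler_norm orbT.
rewrite le_max; apply/orP; left.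
rewrite (le_trans _ (ler_norm K))// (le_trans _ xK)//.
by rewrite -[x ord0 ord0](rV_cons0 (x ord0 ord0, y0)) coord_le_norm.
Qed.

(** A linear section of [testfun_marginal] that commutes with the derivatives
    in the remaining variables. *)
Definition tensor psi : testfun R n.+1 := TestFun (tensor_test psi).

Lemma tensor_derive k psi :
  tensor (testfun_derive k psi) = testfun_derive (lift ord0 k) (tensor psi).
Proof.
apply: testfun_ext => x /=.
rewrite (@cderiveM _ _ _ chi (psi \o @tail R n))//.
have -> : cderive (lift ord0 k) chi x = 0.
  rewrite /chi (@cderiveM _ _ _ (phi0 \o line_map y0) (fun=> (marginal phi0 y0)^-1)).
  - rewrite /cderive [X in X +i* _](@derive_lineS _ _ (fun x => Re (phi0 x))).
    rewrite [X in _ +i* X](@derive_lineS _ _ (fun x => Im (phi0 x))).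
    by rewrite !derive_cst mul0r mulr0 addr0.
  - by have [[rp _] [ip _]] := testfun_real_test phi0;
      split; [exact: (smooth_line y0 rp)|exact: (smooth_line y0 ip)].
  - exact: csmooth_cst.
rewrite mul0r add0r; congr (_ * _); rewrite /cderive.
by rewrite [X in _ = X +i* _](@derive_tailS _ _ (fun x => Re (psi x)))
  [X in _ = _ +i* X](@derive_tailS _ _ (fun x => Im (psi x))).
Qed.

Lemma marginal_tensor psi y : marginal (tensor psi) y = psi y.
Proof.
have [rp ip] := testfun_real_test phi0.
have [k kE] : exists k, k = psi y / marginal phi0 y0 by exists (psi y / marginal phi0 y0).
have E s : tensor psi (rV_cons (0, y) + s *: e0) =
    phi0 (rV_cons (0, y0) + s *: e0) * k.
  rewrite /= /chi /line_map !rV_cons_line tail_cons rV_cons0 kE /=.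
  by rewrite mulrAC mulrA.
have int_lin (u v : 'rV[R]_n.+1 -> R) (a b : R) : real_test u -> real_test v ->
    \int[mu]_s (a * u (rV_cons (0, y0) + s *: e0) - b * v (rV_cons (0, y0) + s *: e0)) =
    a * slice_int setT u (rV_cons (0, y0)) - b * slice_int setT v (rV_cons (0, y0)).
  move=> ru rv; have r0 := real_testZ 0 rv.
  have := @slice_lin3 R n setT (fun x => a * u x) (fun x => 0 * v x) v (rV_cons (0, y0)) b
   measurableT (smooth_continuous (real_testZ a ru).1) (real_testZ a ru).2
   (smooth_continuous r0.1) r0.2 (smooth_continuous rv.1) rv.2.
  have [M uM] := ru.2; have [M' vM] := rv.2.
  rewrite /slice_int.
  rewrite !RintegralZl//; [|exact: (slice_integrable (smooth_continuous rv.1) vM)|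
    exact: (slice_integrable (smooth_continuous ru.1) uM)].
  rewrite mul0r subr0 => <-; congr fine; apply: eq_integral => s _.
  by rewrite mul0r subr0.
have -> : psi y = marginal phi0 y0 * k by rewrite kE mulrC divfK.
apply: eq_ReIm; rewrite ?creM ?cimM /=.
  rewrite mulrC [_ * Im k]mulrC -int_lin//; congr fine.
  apply: eq_integral => s _.
  transitivity (Re (phi0 (rV_cons (0, y0) + s *: e0) * k))%:E; first by rewrite -E.
  by rewrite creM; congr EFin; ring.
rewrite [RHS](_ : _ =
    Re k * slice_int setT (fun x => Im (phi0 x)) (rV_cons (0, y0)) -
    (- Im k) * slice_int setT (fun x => Re (phi0 x)) (rV_cons (0, y0))); last by ring.
rewrite -int_lin//; congr fine.
apply: eq_integral => s _.
  transitivity (Im (phi0 (rV_cons (0, y0) + s *: e0) * k))%:E; first by rewrite -E.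
  by rewrite cimM; congr EFin; ring.
Qed.

Lemma tensorP (c : R[i]) psi1 psi2 :
  tensor (c *: psi1 + psi2) = c *: tensor psi1 + tensor psi2.
Proof.
apply: testfun_ext => x.
have -> : (c *: tensor psi1 + tensor psi2) x =
  c * (chi x * psi1 (tail x)) + chi x * psi2 (tail x) by [].
have -> : tensor (c *: psi1 + psi2) x =
  chi x * (c * psi1 (tail x) + psi2 (tail x)) by [].
ring.
Qed.

End tensor.

End primitive.

(** If all marginals vanish then every test function is a derivative and T is
    0.  Otherwise phi and the tensor of its marginal differ by a derivative,
    so T is determined by the functional psi |-> T (tensor psi) in one variable
    less, to which the induction hypothesis applies. *)
Lemma derivation_invariant_integral (R : realType) n (T : testfun R n -> R[i]) :
  (forall (c : R[i]) phi psi, T (c *: phi + psi) = c * T phi + T psi) ->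
  (forall j phi, T (testfun_derive j phi) = 0) ->
  exists v : R[i], forall phi, T phi = v * integral_C phi.
Proof.
elim: n T => [|n IH] T Tlin Tder.
  have x0 (x : 'rV[R]_0) : x = 0 by apply/rowP => -[].
  have T1 : (fun _ : 'rV[R]_0 => 1 : R[i]) \in @test_function R 0.
    apply/test_function_real_test; split; split; try exact: smooth_cst;
      by exists 0 => x _; rewrite (x0 x) normr0.
  have T0 : T 0 = 0.
    have := Tlin 1 0 0; rewrite scale1r addr0 mul1r.
    by move=> /(congr1 (fun z => z - T 0)); rewrite addrK subrr.
  exists (T (TestFun T1)) => phi.
  have -> : phi = phi 0 *: TestFun T1 + 0.
    by apply: testfun_ext => x; rewrite (x0 x) -[LHS]mulr1 -[LHS]addr0.
  rewrite Tlin T0 addr0 mulrC; congr (_ * _).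
  have D (u : 'rV[R]_0 -> R) : \int[lebesgue_rV 0]_x u x = u 0.
    have uE : u = cst (u 0) by apply/funext => x; rewrite [in LHS](x0 x).
    rewrite /Rintegral /= integral_dirac//=.
      by rewrite indicE in_setT mul1r.
    by apply/measurable_EFinP; rewrite uE; exact: measurable_cst.
  rewrite /integral_C !D.
  have -> : (phi 0 *: TestFun T1 + 0) 0 = phi 0 * 1 + 0 by [].
  by rewrite mulr1 addr0; case: (phi 0).
have Tmarg phi : (forall y, marginal phi y = 0) -> T phi = 0.
  by move=> /marginal_eq0_derive[psi ->]; exact: Tder.
have [[phi0 [y0 c0]]|none] :=
    pselect (exists phi0 : testfun R n.+1, exists y0, marginal phi0 y0 != 0).
  have [v Hv] := IH (fun psi => T (tensor phi0 y0 psi))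
    (fun c psi1 psi2 => etrans (congr1 T (tensorP phi0 y0 c psi1 psi2)) (Tlin _ _ _))
    (fun j psi => etrans (congr1 T (tensor_derive phi0 y0 j psi)) (Tder _ _)).
  exists v => phi; rewrite -integral_marginal -Hv.
  have : T (phi - tensor phi0 y0 (testfun_marginal phi)) = 0.
    by apply: Tmarg => y; rewrite marginalB (marginal_tensor c0); exact: subrr.
  move=> TB; have := Tlin 1 (phi - tensor phi0 y0 (testfun_marginal phi))
    (tensor phi0 y0 (testfun_marginal phi)).
  by rewrite scale1r subrK TB mulr0 add0r.
exists 0 => phi; rewrite mul0r; apply: Tmarg => y; apply/eqP/negPn/negP => cy.
by apply: none; exists phi, y.
Qed.

(** * Linear differential equations with constant coefficients *)
Section complex_ode.
Variable R : realType.
Local Open Scope complex_scope.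
Implicit Types (u v w : R -> R[i]) (z lambda c : R[i]) (t : R).

Lemma cexpD z c : cexp (z + c) = cexp z * cexp c.
Proof.
case: z => a b; case: c => a' b'; rewrite /cexp /= expRD cosD sinD.
by apply: eq_ReIm; rewrite ?creM ?cimM /=; ring.
Qed.

Lemma cexp0 : cexp 0 = 1 :> R[i].
Proof. by rewrite /cexp /= expR0 cos0 sin0 mulr1 mulr0. Qed.

Definition is_cderive w w' := forall t,
  is_derive t (1 : R) (fun t => Re (w t)) (Re (w' t)) /\
  is_derive t (1 : R) (fun t => Im (w t)) (Im (w' t)).

Lemma is_cderive_ext w w1 w' w1' : is_cderive w w' ->
  (forall t, w t = w1 t) -> (forall t, w' t = w1' t) -> is_cderive w1 w1'.
Proof. by move=> dw /funext <- /funext <-. Qed.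

Lemma is_cderive_cst c : is_cderive (fun=> c) (fun=> 0).
Proof. by move=> t; split; exact: is_derive_cst. Qed.

Lemma is_cderiveD u v u' v' : is_cderive u u' -> is_cderive v v' ->
  is_cderive (fun t => u t + v t) (fun t => u' t + v' t).
Proof.
move=> du dv t; have [ru iu] := du t; have [rv iv] := dv t; split.
  rewrite creD (_ : (fun t => _) = (fun t => Re (u t)) + (fun t => Re (v t))).
    exact: is_deriveD.
  by apply/funext => y; rewrite creD.
rewrite cimD (_ : (fun t => _) = (fun t => Im (u t)) + (fun t => Im (v t))).
  exact: is_deriveD.
by apply/funext => y; rewrite cimD.
Qed.

Lemma is_cderiveM u v u' v' : is_cderive u u' -> is_cderive v v' ->
  is_cderive (fun t => u t * v t) (fun t => u' t * v t + u t * v' t).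
Proof.
move=> du dv t; have [ru iu] := du t; have [rv iv] := dv t; split.
  rewrite (_ : (fun t => _) = (fun t => Re (u t)) * (fun t => Re (v t)) -
    (fun t => Im (u t)) * (fun t => Im (v t))).
    apply: is_derive_eq; rewrite creD !creM /GRing.scale/=; ring.
  by apply/funext => y; rewrite creM.
rewrite (_ : (fun t => _) = (fun t => Re (u t)) * (fun t => Im (v t)) +
  (fun t => Im (u t)) * (fun t => Re (v t))).
  apply: is_derive_eq; rewrite cimD !cimM /GRing.scale/=; ring.
by apply/funext => y; rewrite cimM.
Qed.

Lemma is_cderiveZ c u u' : is_cderive u u' ->
  is_cderive (fun t => c * u t) (fun t => c * u' t).
Proof.
move=> du; apply: (is_cderive_ext (is_cderiveM (is_cderive_cst c) du)) => // t.
by rewrite mul0r add0r.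
Qed.

Lemma is_cderive_id : is_cderive (fun t => t%:C) (fun=> 1).
Proof. by move=> t; split => /=; [exact: is_derive_id|exact: is_derive_cst]. Qed.

Lemma is_cderive_cexp z :
  is_cderive (fun t => cexp (z * t%:C)) (fun t => z * cexp (z * t%:C)).
Proof.
have E t : z * t%:C = (Re z * t) +i* (Im z * t).
  by apply: eq_ReIm; rewrite ?creM ?cimM /=; ring.
have lin (a t : R) : is_derive t (1 : R) (fun t => a * t) a.
  have : is_derive t (1 : R) (a \*: id) (a *: 1) by exact: is_deriveZ.
  by rewrite /GRing.scale/= mulr1.
have dexp (a t : R) : is_derive t (1 : R) (fun t => expR (a * t)) (expR (a * t) * a).
  exact: (@is_derive1_comp _ expR (fun t => a * t)).
have dcos (a t : R) : is_derive t (1 : R) (fun t => cos (a * t)) (- sin (a * t) * a).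
  exact: (@is_derive1_comp _ cos (fun t => a * t)).
have dsin (a t : R) : is_derive t (1 : R) (fun t => sin (a * t)) (cos (a * t) * a).
  exact: (@is_derive1_comp _ sin (fun t => a * t)).
move=> t; split.
  rewrite (_ : (fun t => _) = (fun t => expR (Re z * t)) * (fun t => cos (Im z * t))).
    apply: is_derive_eq; rewrite creM E /GRing.scale/=; ring.
  by apply/funext => y; rewrite E.
rewrite (_ : (fun t => _) = (fun t => expR (Re z * t)) * (fun t => sin (Im z * t))).
  apply: is_derive_eq; rewrite cimM E /GRing.scale/=; ring.
by apply/funext => y; rewrite E.
Qed.

Lemma is_cderiveX n :
  is_cderive (fun t => t%:C ^+ n.+1) (fun t => n.+1%:R * t%:C ^+ n).
Proof.
elim: n => [|n IH]; first by apply: (is_cderive_ext is_cderive_id) => t;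
  rewrite ?expr1 ?mulr1.
apply: (is_cderive_ext (is_cderiveM is_cderive_id IH)) => t; first by rewrite -exprS.
by rewrite mul1r mulrCA -exprS -[in RHS]natr1 mulrDl mul1r addrC.
Qed.

Lemma is_cderive0_cst u : is_cderive u (fun=> 0) -> forall t, u t = u 0.
Proof.
move=> du t; apply: eq_ReIm.
  by apply: (@is_derive_0_is_cst _ (fun t => Re (u t))) => y; exact: (du y).1.
by apply: (@is_derive_0_is_cst _ (fun t => Im (u t))) => y; exact: (du y).2.
Qed.

(** Generated by monomials and sums, so that closure properties are proved by
    induction. *)
Inductive exp_poly1 : (R -> R[i]) -> Prop :=
| exp_poly1_mono c n z : exp_poly1 (fun t => c * t%:C ^+ n * cexp (z * t%:C))
| exp_poly1D u v : exp_poly1 u -> exp_poly1 v -> exp_poly1 (fun t => u t + v t).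

Lemma exp_poly1_0 : exp_poly1 (fun=> 0).
Proof.
have := exp_poly1_mono 0 0 0; congr exp_poly1.
by apply/funext => t; rewrite !mul0r.
Qed.

(** A monomial forcing term c t^n exp(z t) is integrated to degree n + 1 when
    z = lambda is resonant; otherwise dividing by z - lambda leaves a forcing
    term of degree n - 1. *)
Lemma particular_solution lambda v : exp_poly1 v ->
  exists w, exp_poly1 w /\ is_cderive w (fun t => lambda * w t + v t).
Proof.
elim=> {v} [c n z|u v _ [w [pw dw]] _ [w1 [pw1 dw1]]]; last first.
  exists (fun t => w t + w1 t); split; first exact: exp_poly1D.
  apply: (is_cderive_ext (is_cderiveD dw dw1)) => // t; ring.
have [->|zl] := eqVneq z lambda.
  exists (fun t => c / n.+1%:R * t%:C ^+ n.+1 * cexp (lambda * t%:C)).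
  split; first exact: exp_poly1_mono.
  apply: (is_cderive_ext (is_cderiveM (is_cderiveZ (c / n.+1%:R) (is_cderiveX n))
    (is_cderive_cexp lambda))) => // t.
  rewrite [c / _ * (_ * _)]mulrA divfK ?pnatr_eq0//; ring.
have zl0 : z - lambda != 0 by rewrite subr_eq0.
elim: n c => [|n IH] c.
  exists (fun t => c / (z - lambda) * t%:C ^+ 0 * cexp (z * t%:C)).
  split; first exact: exp_poly1_mono.
  apply: (is_cderive_ext (is_cderiveZ (c / (z - lambda)) (is_cderive_cexp z))) => t.
    by rewrite expr0 mulr1.
  by rewrite !expr0 !mulr1; field.
have [w [pw dw]] := IH (- (c / (z - lambda) * n.+1%:R)).
exists (fun t => c / (z - lambda) * t%:C ^+ n.+1 * cexp (z * t%:C) + w t).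
split; first by apply: exp_poly1D => //; exact: exp_poly1_mono.
apply: (is_cderive_ext (is_cderiveD (is_cderiveM (is_cderiveZ (c / (z - lambda))
  (is_cderiveX n)) (is_cderive_cexp z)) dw)) => // t.
move: (t%:C ^+ n) (t%:C ^+ n.+1) (cexp _) (w t) (n.+1%:R) => a b e wt N.
by field.
Qed.

Lemma exp_poly1_ode lambda u v : exp_poly1 v ->
  is_cderive u (fun t => lambda * u t + v t) -> exp_poly1 u.
Proof.
move=> pv du; have [w [pw dw]] := particular_solution lambda pv.
(* the homogeneous solution u - w, freed from its exponential factor *)
pose g t := (u t + -1 * w t) * cexp (- lambda * t%:C).
have dg : is_cderive g (fun=> 0).
  apply: (is_cderive_ext (is_cderiveM (is_cderiveD du (is_cderiveZ (-1) dw))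
    (is_cderive_cexp (- lambda)))) => // t; ring.
have gE := is_cderive0_cst dg.
have -> : u = fun t => w t + g 0 * t%:C ^+ 0 * cexp (lambda * t%:C).
  apply/funext => t; rewrite -(gE t) /g expr0 mulr1 -mulrA -cexpD [- lambda * _]mulNr addNr.
  by rewrite cexp0; ring.
by apply: exp_poly1D => //; exact: exp_poly1_mono.
Qed.

(** Multiply E on the right by the factors A - lambda of the characteristic
    polynomial of A.  The full product is 0 by the Cayley-Hamilton theorem, and
    removing one factor amounts to a scalar equation u' = lambda u + v for
    each entry. *)
Lemma exp_poly1_mx_ode m (A : 'M[R[i]]_m) (E : R -> 'M[R[i]]_m) :
  (forall i j, is_cderive (fun t => E t i j) (fun t => (E t *m A) i j)) ->
  forall i j, exp_poly1 (fun t => E t i j).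
Proof.
case: m A E => [|m] A E dE; first by case.
pose F (ls : seq R[i]) := foldr (fun l B => (A - l%:M) *m B) 1%:M ls.
have dEB (B : 'M[R[i]]_m.+1) i j :
    is_cderive (fun t => (E t *m B) i j) (fun t => (E t *m A *m B) i j).
  have sum (r : seq 'I_m.+1) : is_cderive (fun t => \sum_(k <- r) E t i k * B k j)
      (fun t => \sum_(k <- r) (E t *m A) i k * B k j).
    elim: r => [|k r IH].
      by apply: (is_cderive_ext (is_cderive_cst 0)) => t; rewrite big_nil.
    apply: (is_cderive_ext (is_cderiveD (is_cderiveZ (B k j) (dE i k)) IH)) => t;
      by rewrite big_cons mulrC.
  by apply: (is_cderive_ext (sum _)) => t; rewrite [RHS]mxE.
have [ls Hls] := closed_field_poly_normal (char_poly A).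
have F0 : F ls = 0.
  rewrite -(Cayley_Hamilton A) Hls (monicP (char_poly_monic A)) scale1r.
  elim: ls {Hls} => [|l ls IH] /=; first by rewrite big_nil [RHS]rmorph1.
  by rewrite big_cons rmorphM /= rmorphB /= horner_mx_X horner_mx_C -IH.
have : forall i j, exp_poly1 (fun t => (E t *m F ls) i j).
  move=> i j; rewrite F0; have := exp_poly1_0; congr exp_poly1.
  by apply/funext => t; rewrite mulmx0 mxE.
elim: ls {Hls F0} => [|l ls IH] /= H.
  by move=> i j; have := H i j; congr exp_poly1; apply/funext => t; rewrite mulmx1.
apply: IH => i j; apply: (@exp_poly1_ode l _ _ (H i j)).
apply: (is_cderive_ext (dEB (F ls) i j)) => // t.
rewrite mulmxBl mulmxBr mulmxA mul_scalar_mx -scalemxAr.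
by rewrite [X in _ = _ + X]mxE [X in _ = _ + (_ + X)]mxE [X in _ = _ + (_ - X)]mxE addrC subrK.
Qed.

End complex_ode.

(** * Exponential polynomials in several variables *)
Section exponential_polynomials.
Import -(notations) mpoly.
Variables (R : realType) (d : nat).
Local Open Scope complex_scope.
Implicit Types (p q : 'rV[R]_d -> R[i]).

(** Generated by single terms and sums, so that closure properties are proved
    by induction; see [exp_polyP]. *)
Inductive exp_poly : ('rV[R]_d -> R[i]) -> Prop :=
| exp_poly_term (P : mpoly.mpoly d R[i]) (lambda : 'rV[R[i]]_d) :
    exp_poly (fun x => poly_eval P x * cexp (cpairing lambda x))
| exp_polyD p q : exp_poly p -> exp_poly q -> exp_poly (fun x => p x + q x).

Lemma exp_polyP p : exp_poly p -> exponential_polynomial p.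
Proof.
elim=> {p} [P lambda|p q _ [m [P [la Hp]]] _ [m' [P' [la' Hq]]]].
  by exists 1%N, (fun=> P), (fun=> lambda) => x; rewrite big_ord1.
exists (m + m')%N, (fun k => match fintype.split k with inl i => P i | inr i => P' i end),
  (fun k => match fintype.split k with inl i => la i | inr i => la' i end) => x.
rewrite big_split_ord /= Hp Hq; congr (_ + _).
  by apply: eq_bigr => i _; rewrite (unsplitK (inl i)).
by apply: eq_bigr => i _; rewrite (unsplitK (inr i)).
Qed.

Lemma cpairingD (la mu : 'rV[R[i]]_d) x :
  cpairing (la + mu) x = cpairing la x + cpairing mu x.
Proof. by rewrite /cpairing -big_split; apply: eq_bigr => j _; rewrite mxE mulrDl. Qed.

Lemma cpairing0 (x : 'rV[R]_d) : cpairing 0 x = 0.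
Proof. by rewrite /cpairing big1// => j _; rewrite mxE mul0r. Qed.

Lemma cpairing_delta (z : R[i]) k (x : 'rV[R]_d) :
  cpairing (z *: delta_mx 0 k) x = z * (x ord0 k)%:C.
Proof.
rewrite /cpairing (bigD1 k)//= big1 ?addr0; last first.
  by move=> j jk; rewrite !mxE (negbTE jk) /= mulr0 mul0r.
by rewrite !mxE !eqxx mulr1.
Qed.

Lemma exp_polyM p q : exp_poly p -> exp_poly q -> exp_poly (fun x => p x * q x).
Proof.
move=> pp; elim: pp q => {p} [P la q|p p' _ IHp _ IHp' q pq]; last first.
  have := exp_polyD (IHp q pq) (IHp' q pq); congr exp_poly.
  by apply/funext => x; rewrite mulrDl.
elim=> {q} [Q mu|q q' _ IHq _ IHq'].
  have := exp_poly_term (P * Q) (la + mu); congr exp_poly; apply/funext => x.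
  rewrite cpairingD cexpD /poly_eval mpoly.mevalM; ring.
have := exp_polyD IHq IHq'; congr exp_poly.
by apply/funext => x; rewrite mulrDr.
Qed.

Lemma exp_poly_cst c : exp_poly (fun=> c).
Proof.
have := exp_poly_term (mpoly.mpolyC d c) 0; congr exp_poly; apply/funext => x.
by rewrite /poly_eval mpoly.mevalC cpairing0 cexp0 mulr1.
Qed.

Lemma exp_poly_sum I (r : seq I) (p : I -> 'rV[R]_d -> R[i]) :
  (forall i, exp_poly (p i)) -> exp_poly (fun x => \sum_(i <- r) p i x).
Proof.
move=> pp; elim: r => [|i r IH].
  have := exp_poly_cst 0; congr exp_poly; apply/funext => x.
  by rewrite big_nil.
have := exp_polyD (pp i) IH; congr exp_poly; apply/funext => x.
by rewrite big_cons.
Qed.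

Lemma exp_poly_coord (u : R -> R[i]) k :
  exp_poly1 u -> exp_poly (fun x => u (x ord0 k)).
Proof.
elim=> {u} [c n z|u v _ IHu _ IHv]; last exact: exp_polyD.
have := exp_poly_term (mpoly.mpolyC d c * mpoly.mpolyX R[i] (mpoly.mnm1 k) ^+ n)
  (z *: delta_mx 0 k).
congr exp_poly; apply/funext => x.
rewrite cpairing_delta /poly_eval mpoly.mevalM mpoly.mevalC rmorphXn /=.
by rewrite mpoly.mevalXU.
Qed.

(** A homomorphism is the product of its restrictions to the coordinate
    axes. *)
Lemma exp_poly_mx_hom m (C : 'rV[R]_d -> 'M[R[i]]_m) :
  C 0 = 1%:M -> (forall x y, C (x + y) = C x *m C y) ->
  (forall k i j, exp_poly1 (fun t => C (t *: delta_mx 0 k) i j)) ->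
  forall i j, exp_poly (fun x => C x i j).
Proof.
move=> C0 CD C1.
have H (r : seq 'I_d) i j :
    exp_poly (fun x => C (\sum_(k <- r) x ord0 k *: delta_mx 0 k) i j).
  elim: r i j => [|k r IH] i j.
    have := exp_poly_cst ((1%:M : 'M[R[i]]_m) i j); congr exp_poly; apply/funext => x.
    by rewrite big_nil C0.
  have := @exp_poly_sum _ (index_enum 'I_m) (fun l x => C (x ord0 k *: delta_mx 0 k) i l *
     C (\sum_(k <- r) x ord0 k *: delta_mx 0 k) l j)
     (fun l => exp_polyM (exp_poly_coord k (C1 k i l)) (IH l j)).
  congr exp_poly; apply/funext => x.
  by rewrite big_cons CD mxE.
move=> i j; have := H (index_enum 'I_d) i j; congr exp_poly; apply/funext => x.
by rewrite [in RHS](row_sum_delta x).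
Qed.

End exponential_polynomials.

(** * The finite dimensional space of translates *)
Section closure_properties.
Variables (R : realType) (d : nat).
Local Open Scope complex_scope.
Local Notation normc := ComplexField.Normc.normc.
Implicit Types (phi psi : testfun R d) (G : functional R d).

Lemma derivs_le_translate N M phi x : derivs_le N M phi -> derivs_le N M (translate x phi).
Proof.
move=> H s sN y.
have E u := congr1 (@^~ y) (@partials_shift R d s u (- x)).
have [H1 H2] := H s sN (y - x); split.
  by rewrite [X in `|X|](E (fun y => Re (phi y))).
by rewrite [X in `|X|](E (fun y => Im (phi y))).
Qed.

Lemma derivs_leW N N' M phi : (N <= N')%N -> derivs_le N' M phi -> derivs_le N M phi.
Proof. by move=> NN H s sN; apply: H; exact: leq_trans NN. Qed.

Lemma bounded_linear_translate G x : bounded_linear G ->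
  bounded_linear (fun phi => G (translate x phi)).
Proof.
move=> dG; split=> [c phi psi|K].
  rewrite -(dG.1 c); congr G; exact: testfun_ext.
have [C [N [C0 H]]] := dG.2 (K + `|x|); exists C, N; split=> // phi M sK HM.
apply: H; last exact: derivs_le_translate.
move=> y; rewrite translateE => /sK yx.
by rewrite -(subrK x y) (le_trans (ler_normD _ _))// lerD2r.
Qed.

Lemma bounded_linear_sum (I : finType) (G : I -> functional R d) (a : I -> R[i]) :
  (forall i, bounded_linear (G i)) -> bounded_linear (fun phi => \sum_i a i * G i phi).
Proof.
move=> dG; split=> [c phi psi|K].
  rewrite mulr_sumr -big_split /=; apply: eq_bigr => i _.
  rewrite (dG i).1; ring.
have /choice[CN HCN] i : exists CN : R * nat, 0 <= CN.1 /\ forall phi (M : R),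
    (forall x, phi x != 0 -> `|x| <= K) -> derivs_le CN.2 M phi ->
    normc (G i phi) <= CN.1 * M.
  by have [C [N H]] := (dG i).2 K; exists (C, N).
exists (\sum_i normc (a i) * (CN i).1), (\max_i (CN i).2)%N; split.
  by apply: sumr_ge0 => i _; rewrite mulr_ge0 ?normc_ge0//; have [] := HCN i.
move=> phi M sK HM; apply: (le_trans (normc_sum _ _)).
rewrite mulr_suml; apply: ler_sum => i _.
rewrite ComplexField.Normc.normcM -mulrA ler_wpM2l ?normc_ge0//.
apply: (HCN i).2 => //; apply: derivs_leW HM.
exact: leq_bigmax.
Qed.

End closure_properties.

Section linear_recurrence.

(** Expanding the n + 1 vectors in a basis with at most n elements gives a
    coordinate matrix with a nontrivial left kernel. *)
Lemma dim_le_relation (K : fieldType) (V : lmodType K) n (v : 'I_n.+1 -> V) :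
  dim_le (lin_span v) n ->
  exists a : 'I_n.+1 -> K, (exists k, a k != 0) /\ lin_comb v a = 0.
Proof.
move=> [m [mn [b [_ bv]]]].
have /choice[c Hc] k : exists c : 'I_m -> K, v k = lin_comb b c.
  have : lin_span b (v k).
    rewrite bv; exists (fun j => (j == k)%:R) => //.
    rewrite /lin_comb (bigD1 k)//= eqxx scale1r big1 ?addr0// => j jk.
    by rewrite (negbTE jk) scale0r.
  by move=> [x _ <-]; exists x.
pose B := \matrix_(k < n.+1, l < m) c k l.
have /rowV0Pn[a] : kermx B != 0.
  rewrite -mxrank_eq0 mxrank_ker subn_eq0 -ltnNge ltnS.
  exact: leq_trans (rank_leq_col B) mn.
move=> /sub_kermxP aB a0; exists (fun k => a 0 k); split.
  apply/not_existsP => H; move/eqP: a0; apply; apply/rowP => k; rewrite mxE.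
  by apply/eqP/negPn/negP; exact: H.
rewrite /lin_comb (eq_bigr (fun k => \sum_l (a 0 k * B k l) *: b l)); last first.
  move=> k _; rewrite Hc /lin_comb scaler_sumr; apply: eq_bigr => l _.
  by rewrite scalerA mxE.
rewrite exchange_big big1// => l _.
rewrite -scaler_suml (_ : \sum_k _ = (a *m B) 0 l); last by rewrite mxE.
by rewrite aB mxE scale0r.
Qed.

Variables (R : realType) (d : nat).
Local Open Scope complex_scope.
Implicit Types (phi : testfun R d) (f : functional R d) (h x : 'rV[R]_d).

Lemma iter_tau k h f phi : iter k (tau h) f phi = f (translate (h *+ k) phi).
Proof.
elim: k phi => [|k IH] phi; first by rewrite mulr0n translate0.
by rewrite iterS /tau -/(translate h phi) IH -translateD -mulrSr.
Qed.

(** The relation is solved for its highest nonzero term; translating it gives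
    recurrences of all larger orders, hence a common order for all the
    [h i]. *)
Lemma tau_recurrence h f n :
  dim_le (lin_span (fun k : 'I_n.+1 => iter k (tau h) f)) n ->
  exists q0, forall q, (q0 <= q)%N -> exists c : nat -> R[i], forall phi,
    f (translate (h *+ q) phi) = \sum_(k < q) c k * f (translate (h *+ k) phi).
Proof.
move=> /dim_le_relation[a [[k0 ak0] a0]].
have rel phi : \sum_(k < n.+1) a k * f (translate (h *+ k) phi) = 0.
  have := congr1 (@^~ phi) a0; rewrite /lin_comb fct_sumE => E.
  by apply: (etrans _ E); apply: eq_bigr => k _; rewrite -iter_tau.
have [q aq qmax] := @arg_maxnP _ k0 (fun k => a k != 0) (fun k => k : nat) ak0.
pose a' k := a (inord k).
exists q => q' /subnKC <-; set j := (q' - q)%N.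
exists (fun k => if (k < j)%N then 0 else - (a' (k - j)%N / a q)) => phi.
have relq psi : \sum_(k < q.+1) a' k * f (translate (h *+ k) psi) = 0.
  rewrite (big_ord_widen n.+1 (fun k => a' k * f (translate (h *+ k) psi)) (ltn_ord q)).
  rewrite big_mkcond -[RHS](rel psi); apply: eq_bigr => k _.
  rewrite /a' inord_val; case: ltnP => // qk.
  have -> : a k = 0; last by rewrite mul0r.
  by apply/eqP/negPn/negP => /qmax /=; rewrite leqNgt qk.
have := relq (translate (h *+ j) phi).
have tj k : translate (h *+ k) (translate (h *+ j) phi) = translate (h *+ (j + k)) phi.
  by rewrite -translateD -mulrnDr addnC.
rewrite big_ord_recr /= tj /a' inord_val addrC => /eqP; rewrite addr_eq0 => /eqP E.
have {E} -> : f (translate (h *+ (q + j)) phi) =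
    - (\sum_(k < q) a' k * f (translate (h *+ k) (translate (h *+ j) phi))) / a q.
  by rewrite -E addnC mulrAC divff// mul1r.
rewrite [(q + j)%N]addnC big_split_ord /= [X in _ = X + _]big1 ?add0r; last first.
  by move=> k _; rewrite /= ltn_ord mul0r.
rewrite mulNr mulr_suml -sumrN; apply: eq_bigr => k _.
by rewrite ltnNge leq_addr /= addKn tj mulNr mulrAC.
Qed.

End linear_recurrence.

Section finite_span.
Variables (R : realType) (d s : nat) (h : 'I_s -> 'rV[R]_d).
Variables (f : functional R d) (df : bounded_linear f).
Local Open Scope complex_scope.
Implicit Types (phi : testfun R d).

(** The family consists of the translates of f by the sums of the a_i h_i with
    0 <= a_i < Q.  Translating by h_i increases a_i, and when a_i reaches Q the
    recurrence lowers it again.  The order Q is taken positive so that f itself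
    belongs to the family. *)
Lemma invariant_family :
  (forall i, exists q0, forall q, (q0 <= q)%N -> exists c : nat -> R[i], forall phi,
    f (translate (h i *+ q) phi) = \sum_(k < q) c k * f (translate (h i *+ k) phi)) ->
  exists N (v : 'I_N -> functional R d) (a0 : 'I_N) (B : 'I_s -> 'M[R[i]]_N),
    [/\ forall b, bounded_linear (v b), f = v a0 &
        forall i phi a, v a (translate (h i) phi) = \sum_b v b phi * B i b a].
Proof.
move=> /choice[q0 Hq0].
pose Q := (\max_i q0 i)%N.+1.
have /choice[c Hc] i : exists c : nat -> R[i], forall phi,
    f (translate (h i *+ Q) phi) = \sum_(k < Q) c k * f (translate (h i *+ k) phi).
  by apply: Hq0; rewrite leqW// leq_bigmax.
pose I : finType := {ffun 'I_s -> 'I_Q}.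
pose v (a : I) phi := f (translate (\sum_i h i *+ a i) phi).
pose spanned (g : functional R d) :=
  exists beta : I -> R[i], forall phi, g phi = \sum_b v b phi * beta b.
have spanned_v b : spanned (v b).
  exists (fun b' => (b' == b)%:R) => phi.
  rewrite (bigD1 b)//= eqxx mulr1 big1 ?addr0// => b' /negbTE ->.
  by rewrite mulr0.
have spanned_sum n (a : 'I_n -> R[i]) (g : 'I_n -> functional R d) :
    (forall k, spanned (g k)) -> spanned (fun phi => \sum_k a k * g k phi).
  move=> /choice[beta Hbeta]; exists (fun b => \sum_k a k * beta k b) => phi.
  under eq_bigr => k _ do rewrite Hbeta mulr_sumr.
  rewrite exchange_big; apply: eq_bigr => b _; rewrite mulr_sumr.
  by apply: eq_bigr => k _; rewrite mulrCA.
pose rest i (a : I) := \sum_(l | l != i) h l *+ a l.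
have vE i (a : I) phi : v a phi = f (translate (h i *+ a i) (translate (rest i a) phi)).
  by rewrite /v (bigD1 i)//= translateD.
pose upd (a : I) i (k : 'I_Q) : I := [ffun l => if l == i then k else a l].
have updE i a k phi : v (upd a i k) phi = f (translate (h i *+ k) (translate (rest i a) phi)).
  rewrite (vE i) ffunE eqxx; congr (f (translate _ (translate _ _))).
  by apply: eq_bigr => l /negbTE li; rewrite ffunE li.
have spanned_shift i a : spanned (fun phi => v a (translate (h i) phi)).
  have E phi : v a (translate (h i) phi) =
      f (translate (h i *+ (a i).+1) (translate (rest i a) phi)).
    by rewrite (vE i) -!translateD; congr (f (translate _ _)); rewrite mulrSr addrAC.
  have [aQ|aQ] := ltnP (a i).+1 Q.
    have [beta Hb] := spanned_v (upd a i (Ordinal aQ)).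
    by exists beta => phi; rewrite E -Hb updE.
  have aiQ : (a i).+1 = Q by apply/eqP; rewrite eqn_leq ltn_ord.
  have [beta Hb] := spanned_sum _ (fun k => c i k) _ (fun k => spanned_v (upd a i k)).
  exists beta => phi; rewrite E aiQ Hc -Hb; apply: eq_bigr => k _.
  by rewrite updE.
have /choice[beta Hbeta] (ia : 'I_s * I) : exists beta : I -> R[i], forall phi,
    v ia.2 (translate (h ia.1) phi) = \sum_b v b phi * beta b.
  exact: (spanned_shift ia.1 ia.2).
exists #|I|, (fun a => v (enum_val a)), (enum_rank ([ffun=> ord0] : I)),
  (fun i => \matrix_(b, a) beta (i, enum_val a) (enum_val b)); split.
- by move=> b; exact: bounded_linear_translate.
- rewrite enum_rankK; apply/funext => phi; rewrite /v big1 ?translate0// => i _.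
  by rewrite ffunE mulr0n.
- move=> i phi a; rewrite (Hbeta (i, enum_val a)) (reindex (@enum_val _ I)) /=.
    by apply: eq_bigr => b _; rewrite mxE.
  exact: onW_bij (@enum_val_bij I).
Qed.

End finite_span.

Lemma row_free_extend (K : fieldType) m n (W : 'M[K]_(m, n)) (v : 'rV[K]_n) :
  row_free W -> ~~ (v <= W)%MS -> row_free (col_mx W v).
Proof.
move=> Wf vW; rewrite /row_free eqn_leq rank_leq_row /=.
have : (W < W + v)%MS by rewrite ltmxE addsmxSl /= addsmx_sub submx_refl.
rewrite ltmxErank => /andP[_]; rewrite (eqP Wf) addsmxE.
by apply: leq_trans; rewrite addn1.
Qed.

Section dual_system.
Variables (R : realType) (T : Type) (N : nat) (v : T -> 'rV[R[i]]_N).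

(** A linearly independent family of values of v with as many elements as
    possible. *)
Lemma dual_system : exists m (Phi : 'I_m -> T) (W : 'M[R[i]]_(m, N)),
  [/\ forall j, row j W = v (Phi j), row_free W & forall x, (v x <= W)%MS].
Proof.
pose P m := `[< exists Phi : 'I_m -> T, row_free (\matrix_j v (Phi j)) >].
have P0 : P 0%N.
  apply/asboolP; have Phi : 'I_0 -> T by case.
  by exists Phi; rewrite /row_free -leqn0 rank_leq_row.
have bnd m : P m -> (m <= N)%N.
  by move=> /asboolP[Phi /eqP <-]; exact: rank_leq_col.
have [m /asboolP[Phi fPhi] mmax] := ex_maxnP (ex_intro (fun m => is_true (P m)) 0%N P0) bnd.
exists m, Phi, (\matrix_j v (Phi j)); split=> // [j|x]; first exact: rowK.
apply/negPn/negP => vx; have := row_free_extend fPhi vx => F.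
have : P (m + 1)%N.
  apply/asboolP.
  exists (fun k => match fintype.split k with inl j => Phi j | inr _ => x end).
  congr (is_true (row_free _)): F; apply/row_matrixP => k; rewrite rowK.
  case: (split_ordP k) => j ->.
    by rewrite rowKu rowK.
  by rewrite rowKd row_id.
by move=> /mmax; rewrite addn1 ltnn.
Qed.

End dual_system.

(** * The matrix of translations *)
Section reflection.
Variables (R : realType) (d : nat).
Local Open Scope complex_scope.

Lemma is_derive_of_line (V : normedModType R) (u : V -> R) x v l :
  is_derive (0 : R) (1 : R) (fun t => u (x + t *: v)) l -> is_derive x v u l.
Proof.
have e : (fun h : R => h^-1 *: (((fun t => u (x + t *: v)) \o shift 0) (h *: 1)
    - u (x + 0 *: v))) =
  (fun h => h^-1 *: ((u \o shift x) (h *: v) - u x)).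
  apply/funext => h /=; rewrite scale0r !addr0 [_ *: 1]mulr1.
  by rewrite [h *: v + x]addrC.
by case; rewrite /derivable /derive e => dv lE; split.
Qed.

Lemma is_derive_reflect (u : 'rV[R]_d -> R) j x : smooth u ->
  is_derive x (delta_mx 0 j) (fun x => u (- x)) (- 'D_(delta_mx 0 j) u (- x)).
Proof.
move=> su; apply: is_derive_of_line.
have := is_derive_line (x := - x) (t := - 0) (smooth_derivable j _ su).
rewrite oppr0 scale0r addr0 => D.
have D' : is_derive (- 0 : R) (1 : R) (fun t => u (- x + t *: delta_mx 0 j))
    ('D_(delta_mx 0 j) u (- x)) by rewrite oppr0.
have := @is_derive1_comp _ (fun t => u (- x + t *: delta_mx 0 j)) (fun t => - t) 0 _ _
  D' (is_deriveNid _ _).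
rewrite mulrN1; congr (is_derive _ _ _ _); apply/funext => t /=.
by rewrite opprD scaleNr.
Qed.

Lemma smooth_reflect (u : 'rV[R]_d -> R) : smooth u -> smooth (fun x => u (- x)).
Proof.
move=> su; apply: (@smooth_coind _ _ [set w | exists v, smooth v /\ w = fun x => v (- x)]);
  last by exists u.
move=> {u su} _ [u [su ->]]; split=> [x|j].
  apply: (@continuous_comp _ _ _ (fun x : 'rV[R]_d => - x) u).
    exact: opp_continuous.
  exact: smooth_continuous.
split=> [x|]; first by have [] := is_derive_reflect j x su.
exists (fun x => - 'D_(delta_mx 0 j) u x); split.
  by apply: smoothN; exact: smooth_derive.
by apply/funext => x; have [] := is_derive_reflect j x su.
Qed.

Lemma csmooth_reflect (g : 'rV[R]_d -> R[i]) : csmooth g -> csmooth (fun x => g (- x)).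
Proof.
by move=> [rg ig]; split; [exact: (smooth_reflect rg)|exact: (smooth_reflect ig)].
Qed.

Lemma cderive_reflect j (g : 'rV[R]_d -> R[i]) x : csmooth g ->
  cderive j (fun x => g (- x)) x = - cderive j g (- x).
Proof.
move=> [rg ig]; have [_ r] := is_derive_reflect j x rg.
have [_ i] := is_derive_reflect j x ig.
by apply: eq_ReIm => /=; [exact: r|exact: i].
Qed.

Lemma cderive_cst j (c : R[i]) (x : 'rV[R]_d) : cderive j (fun=> c) x = 0.
Proof. by rewrite /cderive !derive_cst. Qed.

Lemma cderiveD j (g k : 'rV[R]_d -> R[i]) x : csmooth g -> csmooth k ->
  cderive j (fun x => g x + k x) x = cderive j g x + cderive j k x.
Proof.
move=> [rg ig] [rk ik]; apply: eq_ReIm; rewrite ?creD ?cimD /=.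
  rewrite (_ : (fun y => _) = (fun y => Re (g y)) \+ (fun y => Re (k y))).
    by rewrite deriveD//; exact: smooth_derivable.
  by apply/funext => y; rewrite creD.
rewrite (_ : (fun y => _) = (fun y => Im (g y)) \+ (fun y => Im (k y))).
  by rewrite deriveD//; exact: smooth_derivable.
by apply/funext => y; rewrite cimD.
Qed.

Lemma cderive_lin (I : Type) (r : seq I) j (a : I -> R[i]) (g : I -> 'rV[R]_d -> R[i]) x :
  (forall i, csmooth (g i)) ->
  cderive j (fun x => \sum_(i <- r) a i * g i x) x =
  \sum_(i <- r) a i * cderive j (g i) x.
Proof.
move=> sg; elim: r => [|i r IH].
  rewrite big_nil (_ : (fun x => _) = fun=> 0) ?cderive_cst//.
  by apply/funext => y; rewrite big_nil.
rewrite (_ : (fun x => _) = fun x => a i * g i x + \sum_(i <- r) a i * g i x).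
  have sc i' := csmoothM (csmooth_cst d (a i')) (sg i').
  rewrite cderiveD//; last exact: csmooth_sum.
  by rewrite IH big_cons cderiveM ?cderive_cst ?mul0r ?add0r//; exact: csmooth_cst.
by apply/funext => y; rewrite big_cons.
Qed.

End reflection.

Lemma dense_eq0 (R : realType) d (S : set 'rV[R]_d) (u : 'rV[R]_d -> R) :
  dense S -> continuous u -> (forall x, S x -> u x = 0) -> forall x, u x = 0.
Proof.
move=> dS cu uS x; apply/eqP/negPn/negP => ux.
have [||y [/= uy Sy]] := dS (u @^-1` [set r | r != 0]).
- by exists x.
- by apply: open_comp; [move=> y _; exact: cu|exact: open_neq].
- by rewrite uS ?eqxx in uy.
Qed.

Section integral_linear.
Variables (R : realType) (d : nat).
Local Open Scope complex_scope.
Implicit Types (phi psi : testfun R d).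

Lemma integral_CP (c : R[i]) phi psi :
  integral_C (c *: phi + psi) = c * integral_C phi + integral_C psi.
Proof.
have lin (u v w : 'rV[R]_d -> R) (a b : R) : real_test u -> real_test v -> real_test w ->
    \int[lebesgue_rV d]_x (a * u x + b * v x + w x) =
    a * (\int[lebesgue_rV d]_x u x) + b * (\int[lebesgue_rV d]_x v x) +
    \int[lebesgue_rV d]_x w x.
  move=> ru rv rw.
  have int (g : 'rV[R]_d -> R) : real_test g ->
      (lebesgue_rV d).-integrable setT (EFin \o g).
    move=> [sg bg]; apply: continuous_bounded_supp_integrable => //.
    exact: smooth_continuous.
  have rau := real_testZ a ru; have rbv := real_testZ b rv.
  rewrite RintegralD ?RintegralD ?RintegralZl//; try exact: int.
  exact: (int _ (real_testD rau rbv)).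
have [r1 i1] := testfun_real_test phi; have [r2 i2] := testfun_real_test psi.
apply: eq_ReIm; rewrite ?creD ?cimD ?creM ?cimM /=.
  rewrite -mulNr -lin//; congr fine; apply: eq_integral => x _; congr EFin.
  by transitivity (Re (c * phi x + psi x)); rewrite // creD creM mulNr.
rewrite -lin//; congr fine; apply: eq_integral => x _; congr EFin.
by transitivity (Im (c * phi x + psi x)); rewrite // cimD cimM.
Qed.

End integral_linear.

Section translation_matrices.
Variables (R : realType) (d m : nat).
Local Open Scope complex_scope.
Implicit Types (phi psi : testfun R d) (x y : 'rV[R]_d).

Variables (F : testfun R d -> 'rV[R[i]]_m) (Phi : 'I_m -> testfun R d).
Hypothesis dF : forall l, bounded_linear (fun phi => F phi 0 l).
Hypothesis FPhi : forall j, F (Phi j) = delta_mx 0 j.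

Definition translate_mx x : 'M[R[i]]_m := \matrix_i F (translate x (Phi i)).
Definition derivation_mx k : 'M[R[i]]_m := \matrix_i F (testfun_derive k (Phi i)).

Let linF (c : R[i]) phi psi : F (c *: phi + psi) = c *: F phi + F psi.
Proof. by apply/rowP => l; rewrite !mxE (dF l).1. Qed.

Let FD phi psi : F (phi + psi) = F phi + F psi.
Proof. by have := linF 1 phi psi; rewrite !scale1r. Qed.

Let F0 : F 0 = 0.
Proof. by apply: (addrI (F 0)); rewrite -FD !addr0. Qed.

Let FZ (c : R[i]) phi : F (c *: phi) = c *: F phi.
Proof. by have := linF c phi 0; rewrite F0 !addr0. Qed.

Let FB phi psi : F (phi - psi) = F phi - F psi.
Proof. by rewrite -scaleN1r addrC linF scaleN1r addrC. Qed.

Let F_sum n (g : 'I_n -> testfun R d) : F (\sum_i g i) = \sum_i F (g i).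
Proof. exact: (big_morph F FD F0). Qed.

Definition translates_linearly x :=
  exists M, forall phi, F (translate x phi) = F phi *m M.

Lemma translates_linearlyE x : translates_linearly x ->
  forall phi, F (translate x phi) = F phi *m translate_mx x.
Proof.
move=> [M HM]; suff -> : translate_mx x = M by [].
by apply/row_matrixP => i; rewrite rowK HM FPhi rowE.
Qed.

Lemma translates_linearly0 : translates_linearly 0.
Proof. by exists 1%:M => phi; rewrite translate0 mulmx1. Qed.

Lemma translates_linearlyD x y : translates_linearly x -> translates_linearly y ->
  translates_linearly (x + y).
Proof.
move=> [M HM] [M' HM']; exists (M' *m M) => phi.
by rewrite translateD HM HM' mulmxA.
Qed.

(** Evaluating at the dual test functions shows that C(-x) C(x) is the
    identity, so C(x) is invertible and its inverse describes the translation
    by -x. *)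
Lemma translates_linearlyN x : translates_linearly x -> translates_linearly (- x).
Proof.
move=> gx; have E phi : F phi = F (translate (- x) phi) *m translate_mx x.
  by rewrite -(translates_linearlyE gx) -translateD subrr translate0.
have V : translate_mx (- x) *m translate_mx x = 1%:M.
  by apply/row_matrixP => i; rewrite row_mul rowK -E FPhi row1.
have [_ Vr] := mulmx1_unit V.
by exists (invmx (translate_mx x)) => phi; rewrite [in RHS]E mulmxK.
Qed.

Lemma translates_linearly_int x (z : int) : translates_linearly x -> translates_linearly (x *~ z).
Proof.
move=> gx; have gn n : translates_linearly (x *+ n).
  by elim: n => [|n IH]; [exact: translates_linearly0|rewrite mulrS; exact: translates_linearlyD].
by case: z => n; [exact: gn|apply: translates_linearlyN; exact: gn].
Qed.

Lemma translates_linearly_sum n (h : 'I_n -> 'rV[R]_d) (a : 'I_n -> int) :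
  (forall i, translates_linearly (h i)) -> translates_linearly (\sum_i h i *~ a i).
Proof.
move=> gh; elim/big_ind: _ => [|x y|i _]; [exact: translates_linearly0|exact: translates_linearlyD|].
exact: translates_linearly_int.
Qed.

Lemma csmooth_translate_mx i j : csmooth (fun x => translate_mx x i j).
Proof.
rewrite (_ : (fun x => _) = fun x => F (translate x (Phi i)) 0 j).
  exact: orbit_smooth (dF j) (Phi i).
by apply/funext => x; rewrite mxE.
Qed.

(** Both sides of the identity F(phi(. - x)) = F(phi) C(x) are continuous in
    x. *)
Lemma translates_linearly_dense S : dense S -> (forall x, S x -> translates_linearly x) -> forall x, translates_linearly x.
Proof.
move=> dS gS x; exists (translate_mx x) => phi; apply/rowP => l.
pose g y := F (translate y phi) 0 l + (-1) * \sum_i F phi 0 i * translate_mx y i l.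
have [sr si] : csmooth g.
  apply: csmoothD; first exact: orbit_smooth (dF l) phi.
  apply: csmoothM; first exact: csmooth_cst.
  apply: csmooth_sum => i; apply: csmoothM; first exact: csmooth_cst.
  exact: csmooth_translate_mx.
have g0 y : S y -> g y = 0.
  by move=> /gS gy; rewrite /g (translates_linearlyE gy) mxE mulN1r subrr.
have gx : g x = 0.
  apply: eq_ReIm.
    by apply: (dense_eq0 dS (smooth_continuous sr)) => y Sy; rewrite g0.
  by apply: (dense_eq0 dS (smooth_continuous si)) => y Sy; rewrite g0.
by move/eqP: gx; rewrite /g mulN1r subr_eq0 => /eqP ->; rewrite mxE.
Qed.

Hypothesis all_linear : forall x, translates_linearly x.

Lemma translate_mxE x phi : F (translate x phi) = F phi *m translate_mx x.
Proof. exact: translates_linearlyE. Qed.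

Lemma translate_mxD x y : translate_mx (x + y) = translate_mx x *m translate_mx y.
Proof.
apply/row_matrixP => i; rewrite rowK row_mul rowK -translate_mxE -translateD.
by rewrite addrC.
Qed.

Lemma translate_mx0 : translate_mx 0 = 1%:M.
Proof. by apply/row_matrixP => i; rewrite rowK translate0 FPhi row1. Qed.

Lemma translate_mxV x : translate_mx (- x) *m translate_mx x = 1%:M.
Proof. by rewrite -translate_mxD addNr translate_mx0. Qed.

Lemma cderive_translate_mx k i j x :
  cderive k (fun x => translate_mx x i j) x = - F (translate x (testfun_derive k (Phi i))) 0 j.
Proof.
rewrite (_ : (fun x => _) = fun x => F (translate x (Phi i)) 0 j).
  exact: orbit_cderive (dF j) _ _ _.
by apply/funext => y; rewrite mxE.
Qed.

(** Differentiate F(phi(. - x)) = F(phi) C(x) at x = 0. *)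
Lemma F_derive k phi : F (testfun_derive k phi) = F phi *m derivation_mx k.
Proof.
apply/rowP => l.
have := orbit_cderive (dF l) k phi 0; rewrite translate0.
rewrite (_ : (fun x => _) = fun x => \sum_i F phi 0 i * translate_mx x i l); last first.
  by apply/funext => x; rewrite translate_mxE mxE.
rewrite cderive_lin; last by move=> i; exact: csmooth_translate_mx.
move=> /(congr1 -%R); rewrite opprK => <-; rewrite -sumrN mxE.
by apply: eq_bigr => i _; rewrite cderive_translate_mx translate0 mulrN opprK [in RHS]mxE.
Qed.

Lemma exp_poly_translate_mx i j : exp_poly (fun x => translate_mx x i j).
Proof.
apply: exp_poly_mx_hom; [exact: translate_mx0|exact: translate_mxD|] => k.
apply: (@exp_poly1_mx_ode _ _ (- derivation_mx k)) => {}i {}j t.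
have [rd id] := orbit_is_derive (dF j) k (Phi i) (0 + t *: delta_mx 0 k).
have E : (translate_mx (t *: delta_mx 0 k) *m - derivation_mx k) i j =
    - F (translate (0 + t *: delta_mx 0 k) (testfun_derive k (Phi i))) 0 j.
  rewrite add0r -translate_derive F_derive mulmxN mxE; congr (- _).
  by rewrite !mxE; apply: eq_bigr => l _; rewrite [in LHS]mxE.
rewrite E; split.
  have [dr <-] := rd; have := is_derive_line dr.
  by congr (is_derive _ _ _ _); apply/funext => t'; rewrite add0r mxE.
have [di <-] := id; have := is_derive_line di.
by congr (is_derive _ _ _ _); apply/funext => t'; rewrite add0r mxE.
Qed.

Let csmoothV i j : csmooth (fun x => translate_mx (- x) i j).
Proof. exact: (csmooth_reflect (csmooth_translate_mx i j)). Qed.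

Let untwist i j phi := testfunM (csmoothV i j) phi.
Let twist i j phi := testfunM (csmooth_translate_mx i j) phi.

(** The coordinates of F with the action of translations undone: if F is
    integration against a combination of the rows of C, then T_i is a multiple of the
    integral. *)
Let T i phi : R[i] := \sum_j F (untwist j i phi) 0 j.

Lemma testfun_sumE n (g : 'I_n -> testfun R d) x : (\sum_i g i) x = \sum_i g i x.
Proof. exact: (big_morph (fun phi : testfun R d => phi x)). Qed.

Let untwist_derive j i k psi :
  untwist j i (testfun_derive k psi) = testfun_derive k (untwist j i psi) -
    \sum_l derivation_mx k j l *: untwist l i psi.
Proof.
apply: testfun_ext => x.
have D : cderive k (fun x => translate_mx (- x) j i) x =
    \sum_l derivation_mx k j l * translate_mx (- x) l i.
  apply: (etrans (cderive_reflect k x (csmooth_translate_mx j i))).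
  rewrite cderive_translate_mx opprK translate_mxE F_derive FPhi -mulmxA -rowE.
  by rewrite !mxE.
transitivity (cderive k (fun x => translate_mx (- x) j i * psi x) x -
    (\sum_l derivation_mx k j l *: untwist l i psi) x); last by [].
rewrite testfun_sumE cderiveM; [|exact: csmoothV|exact: csmooth_testfun].
rewrite D mulr_suml addrAC.
have -> : \sum_l (derivation_mx k j l *: untwist l i psi) x =
    \sum_l derivation_mx k j l * translate_mx (- x) l i * psi x.
  by apply: eq_bigr => l _; rewrite -mulrA.
by rewrite subrr add0r.
Qed.

Let T_lin i (c : R[i]) phi psi : T i (c *: phi + psi) = c * T i phi + T i psi.
Proof.
rewrite /T mulr_sumr -big_split /=; apply: eq_bigr => j _.
have -> : untwist j i (c *: phi + psi) = c *: untwist j i phi + untwist j i psi.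
  apply: testfun_ext => x.
  have -> : (c *: untwist j i phi + untwist j i psi) x =
    c * (translate_mx (- x) j i * phi x) + translate_mx (- x) j i * psi x by [].
  have -> : untwist j i (c *: phi + psi) x =
    translate_mx (- x) j i * (c * phi x + psi x) by [].
  ring.
by rewrite linF !mxE.
Qed.

(** By the product rule the derivative of the factor C(-x) contributes the
    derivation matrix, which cancels the one that comes from [F_derive]. *)
Let T_derive i k psi : T i (testfun_derive k psi) = 0.
Proof.
rewrite /T; under eq_bigr => j _.
  rewrite untwist_derive FB F_derive F_sum mxE [X in _ + X]mxE summxE.
  under [X in _ - X]eq_bigr => l _ do rewrite FZ mxE.
  rewrite mxE; over.
by rewrite sumrB [X in _ - X]exchange_big; apply/eqP; rewrite subr_eq0;
  apply/eqP; apply: eq_bigr => j _; apply: eq_bigr => l _; rewrite mulrC.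
Qed.

Let F_twist j phi : F phi 0 j = \sum_i T i (twist i j phi).
Proof.
rewrite exchange_big /=.
have E l : \sum_i F (untwist l i (twist i j phi)) 0 l = (l == j)%:R * F phi 0 l.
  rewrite -summxE -F_sum.
  have -> : \sum_i untwist l i (twist i j phi) = (l == j)%:R *: phi.
    apply: testfun_ext => x; rewrite testfun_sumE.
    transitivity ((translate_mx (- x) *m translate_mx x) l j * phi x); last first.
      by rewrite translate_mxV mxE.
    by rewrite mxE mulr_suml; apply: eq_bigr => i _; rewrite -mulrA.
  by rewrite FZ mxE.
rewrite (eq_bigr _ (fun l _ => E l)) (bigD1 j)//= eqxx mul1r big1 ?addr0//.
by move=> l /negbTE ->; rewrite mul0r.
Qed.

Lemma exp_poly_density (w : 'I_m -> R[i]) : exists p : 'rV[R]_d -> R[i],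
  [/\ exp_poly p, csmooth p &
      forall phi, \sum_j F phi 0 j * w j = integral_C (fun x => p x * phi x)].
Proof.
have /choice[v Hv] i : exists v : R[i], forall phi, T i phi = v * integral_C phi.
  by apply: derivation_invariant_integral => *; [exact: T_lin|exact: T_derive].
pose p x := \sum_j \sum_i (v i * w j) * translate_mx x i j.
have sp : csmooth p.
  apply: csmooth_sum => j; apply: csmooth_sum => i.
  by apply: csmoothM; [exact: csmooth_cst|exact: csmooth_translate_mx].
exists p; split=> // [|phi].
  apply: exp_poly_sum => j; apply: exp_poly_sum => i.
  by apply: exp_polyM; [exact: exp_poly_cst|exact: exp_poly_translate_mx].
have L0 : integral_C (0 : testfun R d) = 0.
  have := integral_CP 1 (0 : testfun R d) 0; rewrite scale1r addr0 mul1r.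
  by move=> /(congr1 (fun z => z - integral_C (0 : testfun R d)));
    rewrite addrK subrr.
have LD (f g : testfun R d) : integral_C (f + g) = integral_C f + integral_C g.
  by have := integral_CP 1 f g; rewrite scale1r mul1r.
have LZ c (f : testfun R d) : integral_C (c *: f) = c * integral_C f.
  by have := integral_CP c f 0; rewrite !addr0 L0 addr0.
have L_sum n (g : 'I_n -> testfun R d) :
    integral_C (\sum_i g i) = \sum_i integral_C (g i).
  exact: (big_morph (fun f : testfun R d => integral_C f) LD L0).
have -> : (fun x => p x * phi x) =
    testfun_val (\sum_j \sum_i (v i * w j) *: twist i j phi).
  apply/funext => x; rewrite testfun_sumE mulr_suml; apply: eq_bigr => j _.
  rewrite testfun_sumE mulr_suml; apply: eq_bigr => i _.
  by rewrite -mulrA.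
rewrite L_sum; apply: eq_bigr => j _; rewrite L_sum F_twist mulr_suml.
by apply: eq_bigr => i _; rewrite LZ Hv mulrAC.
Qed.

End translation_matrices.

Lemma csmooth_locally_integrable (R : realType) d (p : 'rV[R]_d -> R[i]) :
  csmooth p -> locally_integrable_C p.
Proof.
move=> [/smooth_continuous cr /smooth_continuous ci]; split.
- exact: continuous_measurable_fun_rV.
- exact: continuous_measurable_fun_rV.
- by move=> K cK; split; apply: continuous_compact_integrable_rV.
Qed.

Theorem theorem2p1 (R : realType) (d : nat) (hd : (1 <= d)%N)
  (s : nat) (h : 'I_s -> 'rV[R]_d)
  (h_dense : dense (range (fun a : 'I_s -> int => \sum_(i < s) h i *~ a i)))
  (f : functional R d) (f_distr : is_distribution f)
  (f_dim : exists n : 'I_s -> nat, forall i : 'I_s,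
    dim_le (lin_span (fun k : 'I_(n i).+1 => iter k (tau (h i)) f)) (n i)) :
  exists p : 'rV[R]_d -> R[i],
    [/\ exponential_polynomial p,
        is_distribution_of p f &
        exists g : 'rV[R]_d -> R[i],
          is_distribution_of g f /\ {ae lebesgue_rV d, forall x, g x = p x}].
Proof.
have df := is_distribution_bounded_linear f_distr.
have [n Hn] := f_dim.
have [N [v [a0 [B [dv fE vB]]]]] :=
  invariant_family df (fun i => tau_recurrence (Hn i)).
pose vec phi := \row_b v b phi.
have [m [Phi [W [WE Wf Wv]]]] := dual_system vec.
have [P [WPK WP1]] : exists P : 'M[R[i]]_(N, m),
    (forall phi, vec phi *m P *m W = vec phi) /\ W *m P = 1%:M.
  by exists (pinvmx W); split=> [phi|]; [exact: mulmxKpV|exact: mulmxVp].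
pose F phi := vec phi *m P.
have FW phi : F phi *m W = vec phi by exact: WPK.
have dF l : bounded_linear (fun phi => F phi 0 l).
  have := bounded_linear_sum (fun b => P b l) dv; congr bounded_linear.
  apply/funext => phi; rewrite [RHS]mxE; apply: eq_bigr => b _.
  by rewrite mulrC; congr (_ * _); rewrite mxE.
have FPhi j : F (Phi j) = delta_mx 0 j.
  by rewrite /F -WE rowE -mulmxA WP1 mulmx1.
have linear_h i : translates_linearly F (h i).
  exists (W *m B i *m P) => phi.
  have E : vec (translate (h i) phi) = vec phi *m B i.
    by apply/rowP => a; rewrite !mxE vB; apply: eq_bigr => b _; rewrite mxE.
  by rewrite !mulmxA FW -E.
have all_linear : forall x, translates_linearly F x.
  apply: (translates_linearly_dense dF FPhi h_dense) => _ [a _ <-].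
  exact: (translates_linearly_sum FPhi a linear_h).
have [p [ep sp fp]] := exp_poly_density dF FPhi all_linear (fun j => W j a0).
have pf : is_distribution_of p f.
  split; first exact: csmooth_locally_integrable.
  move=> phi; rewrite -fp fE.
  have := congr1 (fun u : 'rV_N => u 0 a0) (FW phi); rewrite /vec [RHS]mxE => <-.
  by rewrite mxE.
exists p; split=> //; first exact: exp_polyP.
by exists p; split=> //; exact: aeW.
Qed.
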